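(* Let $v:[0,+\infty)\to\mathbb{R}$ be locally Lipschitz continuous and let $(\mathbf{S}^N)_{N\in\mathbb{N}}$ be a fixed admissible family of sampling maps (as defined in the context). Let $\rho_0\in\mathcal{X}(\mathbb{R})$. For each $N\in\mathbb{N}$ let $X(t)=(x_0(t),\ldots,x_N(t))$, $t\ge 0$, be the unique global solution of the Follow-the-Leader system with $X(0)=\mathbf{S}^N[\rho_0]$, and let $$\rho^N(t,x)=\sum_{i=1}^N R_i(t)\,\mathbf{1}_{[x_{i-1}(t),x_i(t))}(x).$$ Then: (a) For every $T\ge 0$ and every compact set $K\subset\mathbb{R}$, the sequence $(\rho^N)_N$ is strongly (relatively) compact in $C([0,T];L^1(\mathbb{R}))$ equipped with the (semi)norm $\sup_{t\in[0,T]}\|\rho(t,\cdot)\|_{L^1(K)}$, i.e. every subsequence of $(\rho^N)_N$ has a further subsequence converging with respect to this (semi)norm. (b) Every limit function $\rho$, i.e. every measurable $\rho:[0,+\infty)\times\mathbb{R}\to\mathbb{R}$ for which there is a subsequence $(\rho^{N_j})_j$ with $\sup_{t\in[0,T]}\|\rho^{N_j}(t,\cdot)-\rho(t,\cdot)\|_{L^1(K)}\to 0$ for all $T\ge 0$ and all compact $K\subset\mathbb{R}$, is a.e. nonnegative and satisfies $\rho(t,\cdot)\in\mathcal{X}(\mathbb{R})$ for all $t\ge 0$.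
   Context: **Follow-the-Leader system.** For $N\in\mathbb{N}$, $N\ge 1$, let $\mathring{\mathcal{K}}_N=\{(x_0,\ldots,x_N)\in\mathbb{R}^{N+1}: x_0<x_1<\cdots<x_N\}$. For $X=(x_0,\ldots,x_N)\in\mathring{\mathcal{K}}_N$ set $R_i[X]=\frac{1}{N(x_i-x_{i-1})}$, $i=1,\ldots,N$, and write $R_i(t)=R_i[X(t)]$. The Follow-the-Leader system is $$\dot x_0(t)=\min_{R\in[0,R_1(t)]}v(R),\qquad \dot x_N(t)=\max_{R\in[0,R_N(t)]}v(R),$$ and, for $i\in\{1,\ldots,N-1\}$, $$\dot x_i(t)=\begin{cases}\max_{R\in[R_{i+1}(t),R_i(t)]}v(R)&\text{if }R_i(t)\ge R_{i+1}(t),\\ \min_{R\in[R_i(t),R_{i+1}(t)]}v(R)&\text{if }R_i(t)<R_{i+1}(t).\end{cases}$$ For every initial datum in $\mathring{\mathcal{K}}_N$ it has a unique global-in-time solution, which stays in $\mathring{\mathcal{K}}_N$. **Initial data.** For $\alpha>0$ let $\mathcal{M}_\alpha(\mathbb{R})=\{\rho\in L^1(\mathbb{R}):\int_{\mathbb{R}}|x|^\alpha\rho(x)\,dx<+\infty\}$. Let $\mathcal{X}(\mathbb{R})$ be the set of all $\rho\in L^1(\mathbb{R})\cap L^\infty(\mathbb{R})\cap BV(\mathbb{R})$ such that $\rho\in\mathcal{M}_\alpha(\mathbb{R})$ for some $\alpha>0$, $\rho\ge 0$ and $\int_{\mathbb{R}}\rho(y)\,dy=1$. $TV[\cdot]$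 denotes the total variation on $\mathbb{R}$. **Admissible sampling maps.** An admissible family of sampling maps is a family of maps $\mathbf{S}^N:\mathcal{X}(\mathbb{R})\to\mathring{\mathcal{K}}_N$, $N\in\mathbb{N}$, $\mathbf{S}^N[\rho]=(\mathbf{S}^N_0[\rho],\ldots,\mathbf{S}^N_N[\rho])$, such that, denoting by $\mathbf{R}^N[\rho]$ the piecewise constant function $$\mathbf{R}^N[\rho](x)=\sum_{i=1}^N R_i[\mathbf{S}^N[\rho]]\,\mathbf{1}_{[\mathbf{S}^N_{i-1}[\rho],\mathbf{S}^N_i[\rho))}(x),$$ one has for every $\rho\in\mathcal{X}(\mathbb{R})$: (i) $\int_{\mathbb{R}}\varphi\,\mathbf{R}^N[\rho]\,dx\to\int_{\mathbb{R}}\varphi\,\rho\,dx$ as $N\to+\infty$ for all bounded continuous $\varphi:\mathbb{R}\to\mathbb{R}$; (ii) $\|\mathbf{R}^N[\rho]\|_{L^\infty}\le\|\rho\|_{L^\infty}$ for all $N$; (iii) $TV[\mathbf{R}^N[\rho]]\le TV[\rho]$ for all $N$. *)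

(* Defs.v *)
(* Stated with MathComp-Analysis, over an arbitrary [R : realType]. *)
From HB Require Import structures.
From mathcomp Require Import all_boot all_order all_algebra.
From mathcomp Require Import all_classical all_reals all_analysis.

Set Implicit Arguments.
Unset Strict Implicit.
Unset Printing Implicit Defensive.
Import Order.TTheory GRing.Theory Num.Theory.
Import numFieldNormedType.Exports.

Local Open Scope classical_set_scope.
Local Open Scope ring_scope.

(* Test functions: C^1, compactly supported, bounded by 1. *)
Definition test_fun {R : realType} (phi : R -> R) : Prop :=
  [/\ forall x : R, derivable phi x 1,
      continuous (derive1 phi),
      compact (closure [set x | phi x != 0]) &
      forall x, `|phi x| <= 1].

(* Total variation on R of (the a.e. class of) an L^1 function, i.e. the total
   mass of its distributional derivative. It does not depend on the
   representative, unlike the pointwise variation [total_variation] of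
   realfun. *)
Definition tot_var {R : realType} (f : R -> R) : \bar R :=
  ereal_sup [set (\int[@lebesgue_measure R]_x (f x * derive1 phi x)%:E)%E
            | phi in [set phi : R -> R | test_fun phi]].

Definition BV {R : realType} (f : R -> R) : Prop :=
  f \in Lfun (@lebesgue_measure R) 1%E /\ (tot_var f < +oo)%E.

Definition in_M {R : realType} (alpha : R) (f : R -> R) : Prop :=
  f \in Lfun (@lebesgue_measure R) 1%E /\
  (\int[@lebesgue_measure R]_x ((`|x| `^ alpha) * f x)%:E < +oo)%E.

(* Elements of X(R) are a.e. classes; [in_X] is a predicate on representatives
   which is invariant under a.e. modification. *)
Definition in_X {R : realType} (f : R -> R) : Prop :=
  [/\ f \in Lfun (@lebesgue_measure R) 1%E,
      f \in Lfun (@lebesgue_measure R) +oo%E &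
      BV f] /\
  [/\ exists2 alpha : R, 0 < alpha & in_M alpha f,
      {ae @lebesgue_measure R, forall x, 0 <= f x} &
      (\int[@lebesgue_measure R]_x (f x)%:E = 1)%E].

(* Particle positions (x_0, ..., x_N) are stored in ['rV[R]_N.+1]; [pos x i] is
   x_i and [dens x i] is R_i[x], meaningful for i <= N and 1 <= i <= N. *)
Definition pos {R : realType} {N : nat} (x : 'rV[R]_N.+1) (i : nat) : R :=
  x ord0 (inord i).

Definition in_K {R : realType} {N : nat} (x : 'rV[R]_N.+1) : Prop :=
  forall i j : 'I_N.+1, (i < j)%N -> x ord0 i < x ord0 j.

Definition dens {R : realType} {N : nat} (x : 'rV[R]_N.+1) (i : nat) : R :=
  (N%:R * (pos x i - pos x i.-1))^-1.

Definition pc_dens {R : realType} {N : nat} (x : 'rV[R]_N.+1) (y : R) : R :=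
  \sum_(1 <= i < N.+1) dens x i * \1_(`[pos x i.-1, pos x i[) y.

(* These are attained when [v] is continuous on the nonempty [a, b]. *)
Definition max_on {R : realType} (v : R -> R) (a b : R) : R :=
  sup (v @` `[a, b]).
Definition min_on {R : realType} (v : R -> R) (a b : R) : R :=
  inf (v @` `[a, b]).

Definition FtL_speed {R : realType} (v : R -> R) {N : nat} (x : 'rV[R]_N.+1)
    (i : nat) : R :=
  if i == 0%N then min_on v 0 (dens x 1)
  else if i == N then max_on v 0 (dens x N)
  else if dens x i.+1 <= dens x i then max_on v (dens x i.+1) (dens x i)
  else min_on v (dens x i) (dens x i.+1).

(* Only the values X t for t >= 0 matter. The one-sided derivative at t = 0
   follows from continuity at 0 and the equation for t > 0. *)
Definition FtL_solution {R : realType} (v : R -> R) {N : nat}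
    (x0 : 'rV[R]_N.+1) (X : R -> 'rV[R]_N.+1) : Prop :=
  [/\ X 0 = x0,
      forall t : R, 0 <= t -> in_K (X t),
      forall i, (i <= N)%N ->
        {within `[0, +oo[, continuous (fun t : R => pos (X t) i)} &
      forall (i : nat) (t : R), (i <= N)%N -> 0 < t ->
        is_derive t 1 (fun s : R => pos (X s) i) (FtL_speed v (X t) i)].

(* Sampling maps are total functions, constrained only on X(R) and for N >= 1.
   They are not required to agree on a.e. equal representatives. *)
Definition admissible_sampling {R : realType}
    (S : forall N : nat, (R -> R) -> 'rV[R]_N.+1) : Prop :=
  forall rho : R -> R, in_X rho ->
  [/\ forall N, (0 < N)%N -> in_K (S N rho),
      forall phi : R -> R, continuous phi -> (exists M : R, forall x, `|phi x| <= M) ->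
        (\int[@lebesgue_measure R]_x (phi x * pc_dens (S N rho) x)%:E)%E
          @[N --> \oo] -->
        (\int[@lebesgue_measure R]_x (phi x * rho x)%:E)%E,
      forall N, (0 < N)%N ->
        ('N[@lebesgue_measure R]_+oo[EFin \o pc_dens (S N rho)]
           <= 'N[@lebesgue_measure R]_+oo[EFin \o rho])%E &
      forall N, (0 < N)%N -> (tot_var (pc_dens (S N rho)) <= tot_var rho)%E].

(* C([0,T]; L^1(R)) *)
Definition in_CL1 {R : realType} (T : R) (f : R -> R -> R) : Prop :=
  forall t : R, 0 <= t <= T ->
    f t \in Lfun (@lebesgue_measure R) 1%E /\
    (\int[@lebesgue_measure R]_x `|f s x - f t x|%:E)%E
      @[s --> within `[0, T] (nbhs t)] --> 0%E.

(* sup over t in [0,T] of || f t - g t ||_{L^1(K)} *)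
Definition supL1_dist {R : realType} (T : R) (K : set R) (f g : R -> R -> R) :
    \bar R :=
  ereal_sup [set (\int[@lebesgue_measure R]_(x in K) `|f t x - g t x|%:E)%E
            | t in `[0, T]].

(* Main.v *)
Require Import Defs.
From mathcomp Require Import all_boot all_order all_algebra.
From mathcomp Require Import all_classical all_reals all_analysis.
From mathcomp Require Import measurable_realfun ess_sup_inf.
From mathcomp Require Import ring lra.
Import Order.TTheory GRing.Theory Num.Theory.
Import numFieldNormedType.Exports.
Local Open Scope classical_set_scope.
Local Open Scope ring_scope.

(** The proof rests on two estimates that are uniform in the number of
    particles.

    First, the sum of the absolute jumps of the density, vacuum included on both
    sides, does not increase in time ([sum_jumps_nonincreasing]). Indeed the
    velocity of a particle is the Godunov flux function of [v] at the densities
    behind and ahead of it, so the density cannot grow at a local maximum nor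
    decrease at a local minimum. For a piecewise constant density the sum of the
    jumps is the total variation in the sense of distributions
    ([tot_var_pc_dens_le], [sum_jumps_le_tot_var]), so at time 0 it is at most
    the variation [V] of [rho0]; as the density vanishes at infinity, [V] also
    bounds the density. Secondly, since the densities stay in [0, V], every
    velocity is bounded by a bound [L] for [v] on [0, V]: mass moves by at most
    [L * |t - s|] between the times [s] and [t].

    These two facts, gathered in [tame_flow], give compactness. The primitives
    in space of the densities are equi-Lipschitz in (t, x), so by
    Arzela-Ascoli a subsequence converges uniformly on compact sets. The L^1
    distance of two densities is controlled by the uniform distance of their
    primitives and by their variation ([pc_dens_L1_dist]: replace each density
    by its mean over an interval of length [h] and optimise in [h]). Hence, along
    a suitable subsequence, the densities are Cauchy at a geometric rate in L^1
    on a segment, uniformly in time, and the limit exists by completeness of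
    L^1.

    For a limit density, positivity, the bound [V] and the bound on the total
    variation pass to the limit under local L^1 convergence. Mass and moments
    could escape to infinity, and narrow convergence at time 0 does not bound
    the moments of the approximations. But mass moves by at most [L * t], so
    the integral of a truncated weight [min((|x| + 1) ^ a, M)] at time [t] is at
    most that of [min((|x| + 1 + L * t) ^ a, M)] at time 0 ([pc_dens_transport]),
    whose limit is at most the corresponding moment of [rho0]. Letting [M] grow
    gives the moment of the limit density, and with it that no mass is lost. *)

Set Implicit Arguments.
Unset Strict Implicit.
Unset Printing Implicit Defensive.

(** * Jumps of the density and its primitive *)

(** The density extended by vacuum to the left of x_0 and to the right of x_N;
    with this convention the first and last particles obey the same law as the
    others, see [FtL_speedE]. *)
Definition xdens {R : realType} {N : nat} (x : 'rV[R]_N.+1) (i : nat) : R :=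
  if (0 < i <= N)%N then dens x i else 0.

Definition jump {R : realType} {N : nat} (x : 'rV[R]_N.+1) (i : nat) : R :=
  xdens x i.+1 - xdens x i.

Definition sum_jumps {R : realType} {N : nat} (x : 'rV[R]_N.+1) : R :=
  \sum_(i < N.+1) `|jump x i|.

(** The mass to the left of [y]: the bracket is the length of the part of
    [x_i, x_{i+1}] that lies to the left of [y]. *)
Definition cdf {R : realType} {N : nat} (x : 'rV[R]_N.+1) (y : R) : R :=
  \sum_(i < N) dens x i.+1 *
    (Num.min y (pos x i.+1) - Num.min y (pos x i)).

Lemma sum_by_parts {R : pzRingType} (N : nat) (a m : nat -> R) :
  a 0%N = 0 -> a N.+1 = 0 ->
  \sum_(i < N) a i.+1 * (m i.+1 - m i) =
  - \sum_(i < N.+1) (a i.+1 - a i) * m i.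
Proof.
move=> a0 aN; under [in RHS]eq_bigr do rewrite mulrBl.
rewrite sumrB [X in X - _]big_ord_recr/= [X in _ - X]big_ord_recl/=.
rewrite a0 aN !mul0r addr0 add0r opprB -sumrB.
by apply: eq_bigr => i _; rewrite mulrBr.
Qed.

Section configurations.
Context {R : realType} {N : nat}.
Implicit Types x : 'rV[R]_N.+1.

Lemma posK x : in_K x -> forall i j, (i < j)%N -> (j <= N)%N ->
  pos x i < pos x j.
Proof.
move=> Kx i j ij jN; apply: Kx; rewrite !inordK//.
by rewrite ltnS; apply: leq_trans jN; exact: ltnW.
Qed.

Lemma posS x i : in_K x -> (i < N)%N -> pos x i < pos x i.+1.
Proof. by move=> Kx iN; exact: posK. Qed.

Lemma pos_le x i j : in_K x -> (i <= j)%N -> (j <= N)%N -> pos x i <= pos x j.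
Proof.
by move=> Kx; rewrite leq_eqVlt => /predU1P[->//|ij jN]; exact/ltW/posK.
Qed.

Lemma dens_gt0 x i : in_K x -> (i < N)%N -> 0 < dens x i.+1.
Proof.
move=> Kx iN; rewrite invr_gt0 mulr_gt0 ?ltr0n ?(leq_ltn_trans _ iN)//.
by rewrite subr_gt0 posS.
Qed.

Lemma dens_ge0 x i : in_K x -> (i < N)%N -> 0 <= dens x i.+1.
Proof. by move=> Kx iN; exact/ltW/dens_gt0. Qed.

Lemma dens_mass x i : in_K x -> (i < N)%N ->
  dens x i.+1 * (pos x i.+1 - pos x i) = N%:R^-1.
Proof.
move=> Kx iN; rewrite /dens/= invfM -mulrA mulVf ?mulr1//.
by rewrite subr_eq0 gt_eqF// posS.
Qed.

Lemma xdens0 x : xdens x 0 = 0. Proof. by []. Qed.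

Lemma xdensN x : xdens x N.+1 = 0.
Proof. by rewrite /xdens ltnn andbF. Qed.

Lemma xdensE x i : (i < N)%N -> xdens x i.+1 = dens x i.+1.
Proof. by move=> iN; rewrite /xdens iN. Qed.

Lemma xdens_ge0 x i : in_K x -> 0 <= xdens x i.
Proof.
move=> Kx; rewrite /xdens; case: ifPn => // /andP[].
by case: i => // i _ iN; exact/ltW/dens_gt0.
Qed.

Lemma sum_jump x k : \sum_(i < k) jump x i = xdens x k.
Proof.
rewrite -(big_mkord xpredT (jump x)) /jump.
by rewrite telescope_sumr// xdens0 subr0.
Qed.

Lemma sum_jumps_ge0 x : 0 <= sum_jumps x.
Proof. exact: sumr_ge0. Qed.

(** The density vanishes at infinity, hence it is bounded by its variation. *)
Lemma xdens_le_sum_jumps x k : xdens x k <= sum_jumps x.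
Proof.
have [kN|Nk] := leqP k N.+1; last first.
  by rewrite /xdens [(k <= N)%N]leqNgt (ltnW Nk) andbF sum_jumps_ge0.
rewrite -sum_jump (le_trans (ler_norm _))// (le_trans (ler_norm_sum _ _ _))//.
rewrite /sum_jumps -(big_mkord xpredT (fun i => `|jump x i|)).
rewrite -[leRHS](big_mkord xpredT (fun i => `|jump x i|)).
by rewrite [leRHS](big_cat_nat _ kN)//= lerDl sumr_ge0.
Qed.

Lemma dens_le_sum_jumps x i : (i < N)%N -> dens x i.+1 <= sum_jumps x.
Proof. by move=> iN; rewrite -xdensE// xdens_le_sum_jumps. Qed.

Lemma pc_densE x y : pc_dens x y =
  \sum_(i < N) dens x i.+1 * \1_(`[pos x i, pos x i.+1[) y.
Proof. by rewrite /pc_dens big_add1/= big_mkord. Qed.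

Lemma pc_dens_ge0 x y : in_K x -> 0 <= pc_dens x y.
Proof.
move=> Kx; rewrite pc_densE sumr_ge0// => i _.
by rewrite mulr_ge0// dens_ge0.
Qed.

Lemma pc_dens_steps x y : in_K x -> pc_dens x y =
  \sum_(i < N) dens x i.+1 * ((pos x i <= y)%R%:R - (pos x i.+1 <= y)%R%:R).
Proof.
move=> Kx; rewrite pc_densE; apply: eq_bigr => i _; congr (_ * _).
rewrite indicE mem_setE in_itv/= ltNge.
have := posS Kx (ltn_ord i).
case: (lerP (pos x i) y); case: (lerP (pos x i.+1) y) => /= *; lra.
Qed.

Lemma pc_dens_out x y : in_K x -> (y < pos x 0) || (pos x N <= y) ->
  pc_dens x y = 0.
Proof.
move=> Kx out; rewrite pc_densE big1// => i _; rewrite indicE mem_setE in_itv/=.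
case/orP: out => out.
  by rewrite lt_geF ?mulr0//; apply: lt_le_trans out _; exact/pos_le/ltnW.
by rewrite [_ < pos _ _]le_gtF ?andbF ?mulr0//; apply: le_trans out; exact: pos_le.
Qed.

Let pc_by_parts x (m : nat -> R) :
  \sum_(i < N) dens x i.+1 * (m i.+1 - m i) =
  - \sum_(i < N.+1) jump x i * m i.
Proof.
rewrite -(sum_by_parts _ (xdens0 x) (xdensN x)).
by apply: eq_bigr => i _; rewrite xdensE.
Qed.

Lemma pc_dens_le_sum_jumps x y : in_K x -> pc_dens x y <= sum_jumps x.
Proof.
move=> Kx; rewrite pc_dens_steps//.
have -> : \sum_(i < N) dens x i.+1 *
    ((pos x i <= y)%R%:R - (pos x i.+1 <= y)%R%:R) =
  \sum_(i < N) dens x i.+1 *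
    (- (pos x i.+1 <= y)%R%:R - - (pos x i <= y)%R%:R).
  by apply: eq_bigr => i _; ring.
rewrite (pc_by_parts x (fun i => - (pos x i <= y)%R%:R)) -sumrN.
apply: ler_sum => i _; rewrite mulrN opprK (le_trans (ler_norm _))// normrM.
by case: (pos x i <= y)%R; rewrite ?normr1 ?normr0 ?mulr1 ?mulr0.
Qed.

(** A piecewise constant density differs from its mean over [y, y + h] only
    through the jumps located inside that interval. *)
Lemma pc_dens_mean x (y h : R) : in_K x -> 0 < h ->
  `|h * pc_dens x y - (cdf x (y + h) - cdf x y)| <=
  h * \sum_(i < N.+1) `|jump x i| * \1_(`]pos x i - h, pos x i[) y.
Proof.
move=> Kx h0.
have -> : h * pc_dens x y = - \sum_(i < N.+1) jump x i *
    (- (h * (pos x i <= y)%R%:R)).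
  rewrite -(pc_by_parts x (fun i => - (h * (pos x i <= y)%R%:R))).
  rewrite pc_dens_steps// mulr_sumr.
  by apply: eq_bigr => i _; ring.
have cdfE z : cdf x z = - \sum_(i < N.+1) jump x i * Num.min z (pos x i).
  exact: (pc_by_parts x (fun i => Num.min z (pos x i))).
rewrite !cdfE.
have -> : forall A B C : R, - A - (- B - - C) = - (A - B + C) by move=> *; ring.
rewrite normrN.
(* The jumps sum to zero, so that a constant may be added to their weights. *)
have J0 : \sum_(i < N.+1) jump x i * h = 0.
  by rewrite -mulr_suml sum_jump xdensN mul0r.
rewrite -[X in `|X|]addr0 -[X in _ + X]J0 -sumrB -!big_split/= mulr_sumr.
rewrite (le_trans (ler_norm_sum _ _ _))// ler_sum// => i _.
rewrite -mulrBr -!mulrDr normrM mulrCA ler_wpM2l//.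
rewrite indicE mem_setE in_itv/= ler_norml.
case: (lerP (pos x i) y) => p1; case: (lerP (pos x i - h) y) => p2/=;
  case: (lerP (y + h) (pos x i)) => p3; rewrite ?andbT ?andbF/=;
  (try case: (ltrP (pos x i - h) y) => p4/=); lra.
Qed.

Lemma cdf_mono x y z : in_K x -> y <= z -> cdf x y <= cdf x z.
Proof.
move=> Kx yz; apply: ler_sum => i _.
rewrite ler_wpM2l ?dens_ge0//.
have := posS Kx (ltn_ord i).
case: (lerP y (pos x i.+1)); case: (lerP y (pos x i));
case: (lerP z (pos x i.+1)); case: (lerP z (pos x i)) => /= *; lra.
Qed.

Lemma cdf_ge0 x y : in_K x -> 0 <= cdf x y.
Proof.
move=> Kx; apply: sumr_ge0 => i _; rewrite mulr_ge0 ?dens_ge0//.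
have := posS Kx (ltn_ord i).
by case: (lerP y (pos x i.+1)); case: (lerP y (pos x i)) => /= *; lra.
Qed.

Lemma cdf_le1 x y : in_K x -> cdf x y <= 1.
Proof.
move=> Kx; apply: (@le_trans _ _ (\sum_(i < N) N%:R^-1)); last first.
  rewrite sumr_const card_ord -[N%:R^-1 *+ _]mulr_natr.
  by case: (N) => [|n]; rewrite ?mulr0// mulVf// pnatr_eq0.
apply: ler_sum => i _; rewrite -(dens_mass Kx (ltn_ord i)).
rewrite ler_wpM2l ?dens_ge0//.
have := posS Kx (ltn_ord i).
by case: (lerP y (pos x i.+1)); case: (lerP y (pos x i)) => /= *; lra.
Qed.

Lemma cdf_lipschitz x y z : in_K x ->
  `|cdf x y - cdf x z| <= sum_jumps x * `|y - z|.
Proof.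
move=> Kx; wlog zy : y z / z <= y.
  move=> H; have [/H//|/ltW/H] := leP z y.
  by rewrite [X in X <= _]distrC [X in _ <= _ * X]distrC.
rewrite ger0_norm ?subr_ge0 ?cdf_mono// ger0_norm ?subr_ge0//.
rewrite /cdf -sumrB.
apply: (@le_trans _ _ (\sum_(0 <= i < N) sum_jumps x *
   ((Num.min y (pos x i.+1) - Num.min z (pos x i.+1)) -
    (Num.min y (pos x i) - Num.min z (pos x i))))).
  rewrite big_mkord; apply: ler_sum => i _; rewrite -mulrBr.
  have -> : forall a b c d : R, a - b - (c - d) = a - c - (b - d).
    by move=> *; ring.
  rewrite ler_wpM2r ?dens_le_sum_jumps//.
  have := posS Kx (ltn_ord i).
  case: (lerP y (pos x i.+1)); case: (lerP y (pos x i));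
  case: (lerP z (pos x i.+1)); case: (lerP z (pos x i)) => /= *; lra.
rewrite -mulr_sumr (telescope_sumr (fun i =>
  Num.min y (pos x i) - Num.min z (pos x i)))//.
rewrite ler_wpM2l ?sum_jumps_ge0//.
case: (lerP y (pos x N)); case: (lerP y (pos x 0));
case: (lerP z (pos x N)); case: (lerP z (pos x 0)) => /= *; lra.
Qed.

(** Each particle cell carries the mass 1/N. If every particle moves by at most
    [d], then so does the point of a cell that has a given fraction of its mass
    on the left. *)
Lemma cdf_shift x x' d y : in_K x -> in_K x' ->
  (forall i, (i <= N)%N -> `|pos x i - pos x' i| <= d) ->
  cdf x y <= cdf x' (y + d).
Proof.
move=> Kx Kx' dxx'; apply: ler_sum => i _.
have iN := ltn_ord i.
have := dens_gt0 Kx' iN; have := dens_gt0 Kx iN.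
have := dens_mass Kx' iN; rewrite -(dens_mass Kx iN).
have := posS Kx iN; have := posS Kx' iN.
move: (dxx' _ iN) (dxx' _ (ltnW iN)); rewrite !ler_norml => /andP[+ +] /andP[].
move: (dens x i.+1) (dens x' i.+1) (pos x i.+1) (pos x i) (pos x' i.+1)
  (pos x' i) => r r' b a b' a' h1 h2 h3 h4 ab' ab mass r0 r'0.
have e1 : r' * (b' - a') = r * (b - a) by [].
case: (lerP y a) => ya; case: (lerP y b) => yb.
- rewrite subrr mulr0 mulr_ge0 ?(ltW r'0)//.
  case: (lerP (y + d) a') => ?; case: (lerP (y + d) b') => ?; lra.
- lra.
- have [t /andP[t0 t1] yE] : exists2 t, 0 <= t <= 1 & y = a + t * (b - a).
    exists ((y - a) / (b - a)); last by rewrite divfK; [ring|lra].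
    by rewrite divr_ge0/= ?ler_pdivrMr; lra.
  have ty : a' + t * (b' - a') <= y + d.
    rewrite yE.
    have -> : a' + t * (b' - a') = (1 - t) * a' + t * b' by ring.
    have -> : a + t * (b - a) + d = (1 - t) * (a + d) + t * (b + d) by ring.
    by apply: lerD; apply: ler_wpM2l; lra.
  have -> : r * (y - a) = r' * (t * (b' - a')).
    by rewrite mulrCA e1 yE; ring.
  rewrite ler_wpM2l ?(ltW r'0)//.
  have t2 : t * (b' - a') <= b' - a' by rewrite ler_piMl; lra.
  have t3 : 0 <= t * (b' - a') by rewrite mulr_ge0; lra.
  case: (lerP (y + d) a') => ?; case: (lerP (y + d) b') => ?; lra.
- rewrite -e1 ler_wpM2l ?(ltW r'0)//.
  case: (lerP (y + d) a') => ?; case: (lerP (y + d) b') => ?; lra.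
Qed.

Lemma cdf_dist x x' d y : in_K x -> in_K x' ->
  (forall i, (i <= N)%N -> `|pos x i - pos x' i| <= d) ->
  `|cdf x y - cdf x' y| <= sum_jumps x' * d + sum_jumps x * d.
Proof.
move=> Kx Kx' dxx'.
have d0 : 0 <= d by apply: le_trans (dxx' 0%N _).
have s1 := cdf_shift y Kx Kx' dxx'.
have s2 : cdf x' y <= cdf x (y + d).
  by apply: cdf_shift => // i iN; rewrite distrC dxx'.
have := cdf_lipschitz (y + d) y Kx; have := cdf_lipschitz (y + d) y Kx'.
have -> : y + d - y = d by ring.
rewrite (ger0_norm d0) !ler_norml => /andP[_ h1] /andP[_ h2].
have := mulr_ge0 (sum_jumps_ge0 x) d0; have := mulr_ge0 (sum_jumps_ge0 x') d0.
by move=> *; apply/andP; split; lra.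
Qed.

End configurations.

(** * A maximum principle for finite families of functions *)

(** Only times to the left of [t] are compared, so that [t] may be the end point
    of the time interval on which the maximum is taken. *)
Lemma is_derive_left_max {R : realType} (f : R -> R) (df a t : R) : a < t ->
  (forall s, a <= s <= t -> f s <= f t) -> is_derive t 1 f df -> 0 <= df.
Proof.
move=> at_ fmax [fd <-].
rewrite ['D_1 f t]cvg_at_leftE//.
apply: limr_ge.
  rewrite -(cvg_at_leftE (fun h => h^-1 *: ((f \o shift t) _ - f t))) //.
  apply: cvg_trans fd; apply: cvg_app.
  move=> A [e egt0 Ae]; exists e => // x xe xgt0; apply: Ae => //.
  exact/ltr0_neq0.
near=> h.
have h0 : h < 0 by near: h; exists 1 => /=.
apply: mulr_le0; first by rewrite invr_le0 ltW.
rewrite subr_le0 [_%:A]mulr1; apply: fmax.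
apply/andP; split; last by rewrite /= gerDr ltW.
near: h; exists (t - a); first by rewrite /= subr_gt0.
by move=> h; rewrite /= distrC subr0 ltr_norml => /andP[+ _] _; lra.
Unshelve. all: by end_near. Qed.

(** Subtracting the drift [e * t] makes the derivative of an active function
    strictly negative, which is incompatible with the maximum of the family over
    [0, T] being attained at a positive time. *)
Lemma active_nonincreasing {R : realType} (I : finType) (g dg : I -> R -> R)
    (T M : R) : 0 <= T ->
  (forall k, {within `[0, T], continuous (g k)}) ->
  (forall k (t : R), 0 < t <= T -> is_derive t 1 (g k) (dg k t)) ->
  (forall k (t : R), 0 < t <= T -> (forall j, g j t <= g k t) -> dg k t <= 0) ->
  (forall k, g k 0 <= M) -> forall k, g k T <= M.
Proof.
move=> T0 gc gd gact gM k; apply/ler_addgt0Pr => d d0.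
move: T0; rewrite le_eqVlt => /predU1P[T0|T0].
  by rewrite -T0 (le_trans (gM k))// lerDl ltW.
pose e := d / T; have e0 : 0 < e by rewrite divr_gt0.
pose h j t := g j t - e * t.
have hc j : {within `[0, T], continuous (h j)}.
  apply: within_continuousB => //; apply: continuous_subspaceT => x.
  exact: scaler_continuous.
have /choice[c cP] : forall j, exists c, (0 <= c <= T) /\
    forall t, 0 <= t <= T -> h j t <= h j c.
  move=> j; have [c] := EVT_max (ltW T0) (hc j).
  by rewrite in_itv/= => cT cm; exists c; split => // t tT; apply: cm; rewrite in_itv.
pose j := [arg max_(i > k) h i (c i)]%O.
have jmax i t : 0 <= t <= T -> h i t <= h j (c j).
  move=> tT; apply: le_trans (proj2 (cP i) t tT) _.
  by rewrite /j; case: arg_maxP => // l _; apply.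
have [cT _] := cP j; case/andP: cT => cj0 cjT.
have hkT : h k T <= h j (c j) by apply: jmax; rewrite lexx ltW.
suff cj : c j = 0.
  move: hkT; rewrite cj /h mulr0 subr0 /e divfK ?gt_eqF// lerBlDr => /le_trans.
  by apply; rewrite lerD2r.
apply/eqP; rewrite eq_le cj0 andbT leNgt; apply/negP => cjp.
have cjb : 0 < c j <= T by rewrite cjp.
have act : forall i, g i (c j) <= g j (c j).
  by move=> i; have := jmax i (c j); rewrite cj0 cjT /h => /(_ isT); rewrite lerD2r.
have hd : is_derive (c j) 1 (h j) (dg j (c j) - e).
  apply: is_deriveB; first exact: gd.
  by apply: is_derive_eq (is_deriveZ e (is_derive_id _ _)) _; exact: mulr1.
have : 0 <= dg j (c j) - e.
  apply: (is_derive_left_max cjp _ hd) => s /andP[s0 sc].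
  by apply: jmax; rewrite s0 (le_trans sc).
by have := gact j _ cjb act; lra.
Qed.

(** * The Follow-the-Leader velocities *)

(** The Godunov flux function of [v]: the velocity of a particle with density [a]
    behind it and [b] ahead, see [FtL_speedE]. *)
Definition upwind {R : realType} (v : R -> R) (a b : R) : R :=
  if b <= a then max_on v b a else min_on v a b.

Definition bounded_on_segments {R : realType} (v : R -> R) : Prop :=
  forall V : R, exists L : R, forall u : R, 0 <= u <= V -> `|v u| <= L.

(** Boundedness on segments makes the extrema of [v] comparable with its values,
    and bounds the velocities. *)
Lemma locally_lipschitz_bounded {R : realType} (v : R -> R) :
  [locally [lipschitz v x | x in `[0, +oo[]] -> bounded_on_segments v.
Proof.
move=> hv V.
have [V0|V0] := ltP V 0; first by exists 0 => u /andP[? ?]; lra.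
have vc : {within `[0, V], continuous v}.
  have vc : {within `[0, +oo[, continuous v}.
    apply/subspace_continuousP => a a0.
    have /pinfty_ex_gt0[M M0] := hv (a, a) (conj a0 a0).
    case=> -[P Q] /= [Pa Qa] lipv.
    apply/cvgrPdist_lt => e e0.
    have : nbhs a (P `&` ball a (e / M)).
      by apply: filterI => //; apply: nbhsx_ballx; rewrite divr_gt0.
    apply: filterS => x [Px xa] x0.
    rewrite distrC (@le_lt_trans _ _ (M * `|x - a|))//.
      by apply: (lipv (x, a)) => //=; split => //; exact: nbhs_singleton Qa.
    by rewrite -ltr_pdivlMl// distrC mulrC.
  apply: continuous_subspaceW vc.
  by move=> u /=; rewrite !in_itv/= => /andP[->].
have [c _ cmax] := EVT_max V0 vc.
have [d _ dmin] := EVT_min V0 vc.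
exists (`|v c| + `|v d|) => u uV.
have := cmax u; have := dmin u; rewrite in_itv/= uV => /(_ isT) h1 /(_ isT) h2.
have := ler_norm (v c); have := ler_norm (- v d); rewrite normrN => h3 h4.
have := normr_ge0 (v c); have := normr_ge0 (v d) => h5 h6.
by rewrite ler_norml; apply/andP; split; lra.
Qed.

Section upwind.
Context {R : realType} (v : R -> R) (vb : bounded_on_segments v).

Let image_bounds (a b : R) : 0 <= a -> exists L : R,
  forall w, (v @` `[a, b]) w -> `|w| <= L.
Proof.
move=> a0; have [L HL] := vb b; exists L => w [u + <-].
by rewrite /= in_itv/= => /andP[au ub]; rewrite HL// ub (le_trans a0).
Qed.

Lemma max_on_ge (a b u : R) : 0 <= a -> a <= u <= b -> v u <= max_on v a b.
Proof.
move=> a0 uab; have [L HL] := image_bounds b a0.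
apply: ub_le_sup; last by exists u => //=; rewrite in_itv.
by exists L => w /HL; exact/le_trans/ler_norm.
Qed.

Lemma min_on_le (a b u : R) : 0 <= a -> a <= u <= b -> min_on v a b <= v u.
Proof.
move=> a0 uab; have [L HL] := image_bounds b a0.
apply: ge_inf; last by exists u => //=; rewrite in_itv.
by exists (- L) => w /HL; rewrite ler_norml => /andP[].
Qed.

Lemma upwind_ge (a b : R) : 0 <= b <= a ->
  v a <= upwind v a b /\ v b <= upwind v a b.
Proof.
by case/andP=> b0 ba; rewrite /upwind ba; split; apply: max_on_ge;
  rewrite ?lexx ?ba.
Qed.

Lemma upwind_le (a b : R) : 0 <= a <= b ->
  upwind v a b <= v a /\ upwind v a b <= v b.
Proof.
case/andP=> a0; rewrite le_eqVlt => /predU1P[<-|ab].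
  have : max_on v a a <= v a.
    rewrite /max_on set_itv1 image_set1 sup1//.
  by rewrite /upwind lexx.
by rewrite /upwind (lt_geF ab); split; apply: min_on_le; 
  rewrite ?lexx ?(ltW ab).
Qed.

Lemma upwind_bound (V L a b : R) : (forall u : R, 0 <= u <= V -> `|v u| <= L) ->
  0 <= a <= V -> 0 <= b <= V -> `|upwind v a b| <= L.
Proof.
move=> vL /andP[a0 aV] /andP[b0 bV]; rewrite ler_norml.
have vL' c d : 0 <= c -> d <= V ->
    forall w, (v @` `[c, d]) w -> (- L <= w) && (w <= L).
  move=> c0 dV w [u + <-]; rewrite /= in_itv/= => /andP[cu ud].
  by rewrite -ler_norml vL// (le_trans c0)//= (le_trans ud).
rewrite /upwind; case: (leP b a) => [ba|/ltW ab].
  apply/andP; split.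
    apply: (@le_trans _ _ (v a)); last by apply: max_on_ge; rewrite ?ba/=.
    by have := vL a; rewrite a0 aV ler_norml => /(_ isT)/andP[].
  apply: ge_sup; first by exists (v a), a => //=; rewrite in_itv/= ba lexx.
  by move=> w /(vL' _ _ b0 aV)/andP[].
apply/andP; split; last first.
  apply: (@le_trans _ _ (v a)); first by apply: min_on_le; rewrite ?lexx.
  by have := vL a; rewrite a0 aV ler_norml => /(_ isT)/andP[].
apply: lb_le_inf; first by exists (v a), a => //=; rewrite in_itv/= ab lexx.
by move=> w /(vL' _ _ a0 bV)/andP[].
Qed.

Lemma FtL_speedE (N : nat) (x : 'rV[R]_N.+1) i : in_K x -> (0 < N)%N ->
  (i <= N)%N -> FtL_speed v x i = upwind v (xdens x i) (xdens x i.+1).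
Proof.
move=> Kx N0 iN; rewrite /FtL_speed /upwind.
case: eqP => [->|/eqP i0].
  by rewrite xdens0 xdensE// (lt_geF (dens_gt0 Kx N0)).
case: eqP => [->|/eqP iN'].
  have -> : dens x N = xdens x N by rewrite /xdens N0 leqnn.
  by rewrite xdensN xdens_ge0.
have i1 : (0 < i)%N by rewrite lt0n.
have iN1 : (i < N)%N by rewrite ltn_neqAle iN'.
by rewrite /xdens iN i1/= iN1.
Qed.

End upwind.

(** * The total variation of the density does not increase *)

Section variation_decay.
Context {R : realType} (v : R -> R) (vb : bounded_on_segments v).
Context (N : nat) (N0 : (0 < N)%N) (x0 : 'rV[R]_N.+1) (X : R -> 'rV[R]_N.+1).
Hypothesis solX : FtL_solution v x0 X.

Let KX (t : R) : 0 <= t -> in_K (X t). Proof. by case: solX => _ + _ _; apply. Qed.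

Definition xdens_rate (x : 'rV[R]_N.+1) (i : nat) : R :=
  if (0 < i <= N)%N then
    - (dens x i) ^+ 2 * (N%:R * (FtL_speed v x i - FtL_speed v x i.-1))
  else 0.

Lemma is_derive_xdens (t : R) (i : nat) : 0 < t ->
  is_derive t 1 (fun s : R => xdens (X s) i) (xdens_rate (X t) i).
Proof.
move=> t0; rewrite /xdens /xdens_rate; case: ifPn => [/andP[i0 iN]|_]; last first.
  exact: is_derive_cst.
have [_ _ _ dX] := solX.
have iN1 : (i.-1 <= N)%N by rewrite (leq_trans _ iN)// leq_pred.
have nz : N%:R * (pos (X t) i - pos (X t) i.-1) != 0.
  rewrite mulf_neq0 ?pnatr_eq0 -?lt0n// subr_eq0 gt_eqF//.
  by apply: posK; [exact/KX/ltW|rewrite prednK|].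
have d1 := dX i t iN t0; have d2 := dX _ t iN1 t0.
have [df dfE] : is_derive t 1
    (fun s => N%:R * (pos (X s) i - pos (X s) i.-1))
    (N%:R * (FtL_speed v (X t) i - FtL_speed v (X t) i.-1)).
  exact: (is_deriveZ N%:R (is_deriveB d1 d2)).
apply: DeriveDef; first exact: derivableV.
by rewrite deriveV// dfE /dens exprVn.
Qed.

Lemma continuous_xdens (T : R) (i : nat) :
  {within `[0, T], continuous (fun s : R => xdens (X s) i)}.
Proof.
rewrite /xdens; case: (boolP (0 < i <= N)%N) => [/andP[i0 iN]|_]; last first.
  by apply: continuous_subspaceT => s; exact: cst_continuous.
have [_ _ cX _] := solX.
have iN1 : (i.-1 <= N)%N by rewrite (leq_trans _ iN)// leq_pred.
have cX' j : (j <= N)%N ->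
    {within `[0, T], continuous (fun t : R => pos (X t) j)}.
  move=> jN; apply: continuous_subspaceW (cX j jN).
  by move=> u /=; rewrite !in_itv/= => /andP[->].
apply/subspace_continuousP => s s0.
have /subspace_continuousP/(_ s s0) c1 := cX' _ iN.
have /subspace_continuousP/(_ s s0) c2 := cX' _ iN1.
apply: cvgV; last by apply: cvgM; [exact: cvg_cst|exact: cvgB].
rewrite mulf_neq0 ?pnatr_eq0 -?lt0n// subr_eq0 gt_eqF//.
move: s0; rewrite /= in_itv/= => /andP[s0 _].
by apply: posK; [exact/KX|rewrite prednK|].
Qed.


(** At a local maximum of the density the upwind rule slows the particle behind
    and speeds up the particle ahead, so that the density cannot increase;
    symmetrically at a local minimum. *)
Lemma xdens_rate_le0 (x : 'rV[R]_N.+1) i : in_K x -> (i < N)%N ->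
  xdens x i <= xdens x i.+1 -> xdens x i.+2 <= xdens x i.+1 ->
  xdens_rate x i.+1 <= 0.
Proof.
move=> Kx iN l r; rewrite /xdens_rate /= iN mulNr oppr_le0.
rewrite mulr_ge0 ?sqr_ge0// mulr_ge0// subr_ge0.
rewrite !FtL_speedE// 1?ltnW//.
have [_ h1] : upwind v (xdens x i) (xdens x i.+1) <= v (xdens x i) /\
    upwind v (xdens x i) (xdens x i.+1) <= v (xdens x i.+1).
  by apply: upwind_le => //; rewrite xdens_ge0.
have [h2 _] : v (xdens x i.+1) <= upwind v (xdens x i.+1) (xdens x i.+2) /\
    v (xdens x i.+2) <= upwind v (xdens x i.+1) (xdens x i.+2).
  by apply: upwind_ge => //; rewrite xdens_ge0.
exact: le_trans h2.
Qed.

Lemma xdens_rate_ge0 (x : 'rV[R]_N.+1) i : in_K x -> (i < N)%N ->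
  xdens x i.+1 <= xdens x i -> xdens x i.+1 <= xdens x i.+2 ->
  0 <= xdens_rate x i.+1.
Proof.
move=> Kx iN l r; rewrite /xdens_rate /= iN mulNr oppr_ge0.
rewrite mulr_ge0_le0 ?sqr_ge0// mulr_ge0_le0// subr_le0.
rewrite !FtL_speedE// 1?ltnW//.
have [_ h1] : v (xdens x i) <= upwind v (xdens x i) (xdens x i.+1) /\
    v (xdens x i.+1) <= upwind v (xdens x i) (xdens x i.+1).
  by apply: upwind_ge => //; rewrite xdens_ge0.
have [h2 _] : upwind v (xdens x i.+1) (xdens x i.+2) <= v (xdens x i.+1) /\
    upwind v (xdens x i.+1) (xdens x i.+2) <= v (xdens x i.+2).
  by apply: upwind_le => //; rewrite xdens_ge0.
exact: le_trans h1.
Qed.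

Let sgn (s : {ffun 'I_N.+1 -> bool}) (i : nat) : R := (-1) ^+ s (inord i).

Let signed_sum s (x : 'rV[R]_N.+1) : R := \sum_(i < N.+1) sgn s i * jump x i.

Let signed_sum_le s x : signed_sum s x <= sum_jumps x.
Proof.
apply: ler_sum => i _; rewrite (le_trans (ler_norm _))// normrM /sgn.
by rewrite normr_sign mul1r.
Qed.

Let jump_signs (x : 'rV[R]_N.+1) : {ffun 'I_N.+1 -> bool} :=
  [ffun i : 'I_N.+1 => jump x i < 0].

Let signed_sum_eq x : signed_sum (jump_signs x) x = sum_jumps x.
Proof.
apply: eq_bigr => i _; rewrite /sgn ffunE inord_val.
case: ltP => h; first by rewrite expr1 mulN1r ltr0_norm.
by rewrite expr0 mul1r ger0_norm.
Qed.

Let active_signs s x : (forall r, signed_sum r x <= signed_sum s x) ->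
  forall i, (i <= N)%N -> 0 <= sgn s i * jump x i.
Proof.
move=> act i iN; have := act (jump_signs x); rewrite signed_sum_eq.
rewrite -subr_le0 -sumrB => le0.
have ge0 : forall j : 'I_N.+1, true -> 0 <= `|jump x j| - sgn s j * jump x j.
  move=> j _; rewrite subr_ge0 (le_trans (ler_norm _))// normrM /sgn.
  by rewrite normr_sign mul1r.
have /psumr_eq0P/(_ (inord i) isT) : \sum_(j < N.+1)
    (`|jump x j| - sgn s j * jump x j) = 0.
  by apply/eqP; rewrite eq_le le0 sumr_ge0.
move=> /(_ ge0); rewrite inordK// => /eqP; rewrite subr_eq0 => /eqP <-.
exact: normr_ge0.
Qed.

(** The sum of the absolute jumps is the maximum, over all choices of signs, of
    signed sums of jumps, so [active_nonincreasing] applies. An active choice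
    agrees with the signs of the nonzero jumps; summing by parts, its derivative
    only sees the densities at which the sign changes, that is, local extrema,
    where [xdens_rate_le0] and [xdens_rate_ge0] decide. *)
Lemma sum_jumps_nonincreasing (T : R) : 0 <= T ->
  sum_jumps (X T) <= sum_jumps x0.
Proof.
move=> T0; have [X0 _ _ _] := solX.
rewrite -(signed_sum_eq (X T)).
apply: (@active_nonincreasing R _ (fun s t => signed_sum s (X t))
  (fun s t => \sum_(i < N.+1) sgn s i *
     (xdens_rate (X t) i.+1 - xdens_rate (X t) i)) T) => //.
- move=> s; apply/subspace_continuousP => t tT; apply: cvg_big => [|i _].
    by move=> x; exact: add_continuous.
  have /subspace_continuousP/(_ t tT) c1 := @continuous_xdens T i.
  have /subspace_continuousP/(_ t tT) c2 := @continuous_xdens T i.+1.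
  by apply: cvgM; [exact: cvg_cst|exact: cvgB].
- move=> s t /andP[t0 tT].
  have -> : (fun t => signed_sum s (X t)) =
      \sum_(i < N.+1) (fun t => sgn s i * jump (X t) i).
    by apply/funext => u; rewrite fct_sumE.
  apply: is_derive_sum => i.
  apply: (is_deriveZ (sgn s i)); apply: is_deriveB; exact: is_derive_xdens.
- move=> s t /andP[t0 tT] act.
  have Kt := KX (ltW t0).
  have signs := active_signs act.
  under eq_bigr do rewrite mulrC.
  rewrite -[leLHS]opprK -(@sum_by_parts _ N (xdens_rate (X t)) (sgn s))//; last first.
    by rewrite /xdens_rate ltnn andbF.
  rewrite oppr_le0 sumr_ge0// => i _.
  have := signs _ (ltn_ord i); have := signs _ (ltnW (ltn_ord i)).
  rewrite /sgn /jump.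
  case: (s (inord i)); case: (s (inord i.+1)); rewrite /= ?subrr ?mulr0//.
  + rewrite expr1 expr0 mulN1r mul1r oppr_ge0 subr_le0 subr_ge0 => l r.
    by rewrite mulr_ge0 ?xdens_rate_ge0// opprK addr_ge0.
  + rewrite expr1 expr0 mulN1r mul1r oppr_ge0 subr_le0 subr_ge0 => l r.
    by rewrite mulr_le0 ?xdens_rate_le0// subr_le0 (le_trans (lerN10 _)).
- by move=> s; rewrite X0; exact: signed_sum_le.
Qed.

(** The densities never exceed their variation, hence stay in [0, V]. *)
Lemma pos_lipschitz (V L : R) : (forall u : R, 0 <= u <= V -> `|v u| <= L) ->
  sum_jumps x0 <= V -> forall i, (i <= N)%N -> forall s t : R,
  0 <= s -> 0 <= t -> `|pos (X t) i - pos (X s) i| <= L * `|t - s|.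
Proof.
move=> vL xV i iN s t; wlog st : s t / s <= t.
  move=> H s0 t0; have [st|/ltW ts] := leP s t; first exact: H.
  by rewrite distrC [in leRHS]distrC; exact: H.
move=> s0 t0; have [_ _ cX dX] := solX.
have [||] := @MVT_segment R (fun u => pos (X u) i)
   (fun u => FtL_speed v (X u) i) s t st.
- move=> u; rewrite in_itv/= => /andP[su ut]; apply: dX => //.
  exact: le_lt_trans su.
- apply: continuous_subspaceW (cX i iN) => u /=.
  by rewrite !in_itv/= andbT => /andP[su _]; exact: le_trans su.
move=> r; rewrite in_itv/= => /andP[sr rt] ->; rewrite normrM ler_wpM2r//.
have r0 := le_trans s0 sr; have Kr := KX r0.
have jV k : 0 <= xdens (X r) k <= V.
  rewrite xdens_ge0//= (le_trans (xdens_le_sum_jumps _ _))//.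
  by rewrite (le_trans (sum_jumps_nonincreasing r0)).
by rewrite FtL_speedE//; apply: upwind_bound vL _ _.
Qed.

End variation_decay.

(** * Integrating a piecewise constant density *)

Section pc_dens_integrals.
Context {R : realType} {N : nat}.
Implicit Types (x : 'rV[R]_N.+1) (phi : R -> R).
Local Notation mu := (@lebesgue_measure R).

Lemma continuous_segment_integrable phi (a b : R) : continuous phi ->
  mu.-integrable `[a, b] (EFin \o phi).
Proof.
move=> cphi; apply: continuous_compact_integrable; first exact: segment_compact.
exact: continuous_subspaceT.
Qed.

Lemma measurable_pc_dens x (D : set R) : measurable_fun D (pc_dens x).
Proof.
apply: measurable_sum => i; apply: measurable_funM; first exact: measurable_cst.
by apply: measurable_indic; exact: measurable_itv.
Qed.

Lemma integral_pc_dens x phi : continuous phi ->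
  (\int[mu]_y (pc_dens x y * phi y)%:E =
   \sum_(i < N) (dens x i.+1)%:E *
     \int[mu]_(y in `[pos x i, pos x i.+1]) (phi y)%:E)%E.
Proof.
move=> cphi.
have iphi (i : nat) : mu.-integrable setT
    (fun y => (\1_(`[pos x i, pos x i.+1[) y * phi y)%:E).
  have h : mu.-integrable `[pos x i, pos x i.+1[ (EFin \o phi).
    have := continuous_segment_integrable (pos x i) (pos x i.+1) cphi.
    apply: integrableS => //.
    by move=> y /=; rewrite !in_itv/= => /andP[-> /ltW].
  have mI : measurable (`[pos x i, pos x i.+1[%classic : set R).
    exact: measurable_itv.
  have -> : (fun y => (\1_(`[pos x i, pos x i.+1[) y * phi y)%:E) =
      (EFin \o phi) \_ `[pos x i, pos x i.+1[; last first.
    by apply/(integrable_mkcond _ _).1.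
  apply/funext => y.
  by rewrite patchE indicE; case: ifPn => _; rewrite ?mul1r ?mul0r.
transitivity (\int[mu]_y \sum_(i < N) ((dens x i.+1)%:E *
    (\1_(`[pos x i, pos x i.+1[) y * phi y)%:E))%E.
  apply: eq_integral => y _; rewrite pc_densE mulr_suml -sumEFin.
  by apply: eq_bigr => i _; rewrite -mulrA EFinM.
rewrite integral_sum//; last by move=> i; apply: integrableZl.
apply: eq_bigr => i _; rewrite integralZl//; congr (_ * _)%E.
rewrite -integral_itv_bndo_bndc; last first.
  apply/measurable_EFinP; apply: measurable_funTS.
  exact: continuous_measurable_fun.
rewrite [RHS]integral_mkcond; apply: eq_integral => y _.
by rewrite patchE indicE; case: ifPn => _; rewrite ?mul1r ?mul0r.
Qed.

Lemma integral_derive1 phi (a b : R) : a < b ->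
  (forall y : R, derivable phi y 1) -> continuous (derive1 phi) ->
  (\int[mu]_(y in `[a, b]) (derive1 phi y)%:E = (phi b - phi a)%:E)%E.
Proof.
move=> ab dphi cdphi.
have cphi y : phi z @[z --> y] --> phi y.
  by apply: differentiable_continuous; apply/derivable1_diffP.
rewrite (@continuous_FTC2 _ _ phi)// ?EFinB//.
  exact: continuous_subspaceT.
split => //.
- exact/cvg_at_right_filter/cphi.
- exact/cvg_at_left_filter/cphi.
Qed.

(** In other words the distributional derivative of the density is a sum of
    Dirac masses at the particles, weighted by the jumps. *)
Lemma integral_pc_dens_derive1 x phi : in_K x ->
  (forall y : R, derivable phi y 1) -> continuous (derive1 phi) ->
  (\int[mu]_y (pc_dens x y * derive1 phi y)%:E =
   (- \sum_(i < N.+1) jump x i * phi (pos x i))%:E)%E.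
Proof.
move=> Kx dphi cdphi; rewrite integral_pc_dens//.
rewrite -(@sum_by_parts _ _ (xdens x) (fun i => phi (pos x i)))//; last first.
  exact: xdensN.
rewrite -sumEFin; apply: eq_bigr => i _.
by rewrite integral_derive1 ?posS// xdensE// EFinM.
Qed.

Lemma tot_var_pc_dens_le x : in_K x ->
  (tot_var (pc_dens x) <= (sum_jumps x)%:E)%E.
Proof.
move=> Kx; apply: ge_ereal_sup => _ [phi [dphi cphi _ phi1] <-].
rewrite integral_pc_dens_derive1// lee_fin.
rewrite (le_trans (ler_norm _))// normrN (le_trans (ler_norm_sum _ _ _))//.
by apply: ler_sum => i _; rewrite normrM ler_piMr.
Qed.

Lemma integral_pc_dens1 x : in_K x -> (0 < N)%N ->
  (\int[mu]_y (pc_dens x y)%:E = 1)%E.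
Proof.
move=> Kx N0.
have := @integral_pc_dens x (cst 1) (@cst_continuous _ _ _).
under eq_integral do rewrite /cst mulr1.
move=> ->; rewrite (eq_bigr (fun=> (N%:R^-1)%:E)).
  rewrite sumEFin sumr_const card_ord -[N%:R^-1 *+ _]mulr_natr mulVf//.
  by rewrite pnatr_eq0 -lt0n.
move=> i _; rewrite -(dens_mass Kx (ltn_ord i)) EFinM; congr (_ * _)%E.
rewrite (eq_integral (cst 1%E))// integral_cst//= mul1e lebesgue_measure_itv/=.
by rewrite lte_fin posS.
Qed.

Lemma integrable_pc_dens x (D : set R) : measurable D -> in_K x ->
  mu.-integrable D (EFin \o pc_dens x).
Proof.
move=> mD Kx.
have [N0|N0] := posnP N.
  have -> : EFin \o pc_dens x = cst 0%E.
    apply/funext => y; rewrite /pc_dens /=; move: x {Kx}; rewrite N0 => x.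
    by rewrite big_nil.
  exact: integrable0.
apply: (@integrableS _ _ _ mu setT) => //.
apply/integrableP; split.
  by apply/measurable_EFinP; exact: measurable_pc_dens.
under eq_integral do rewrite /= ger0_norm ?pc_dens_ge0//.
by rewrite integral_pc_dens1// ltry.
Qed.

Lemma integral_indic_sum_le (n : nat) (c : nat -> R) (I : nat -> set R) (h : R)
    (D : set R) : measurable D -> (forall i, 0 <= c i) ->
  (forall i, measurable (I i)) -> (forall i, (mu (I i) <= h%:E)%E) ->
  (\int[mu]_(y in D) (\sum_(i < n) c i * \1_(I i) y)%:E <=
   (h * \sum_(i < n) c i)%:E)%E.
Proof.
move=> mD c0 mI Ih.
under eq_integral do rewrite -sumEFin.
rewrite ge0_integral_sum//.
- rewrite mulr_sumr -sumEFin; apply: lee_sum => i _.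
  under eq_integral do rewrite EFinM.
  rewrite ge0_integralZl_EFin//; last first.
    by apply/measurable_EFinP; apply: measurable_indic; exact: mI.
  rewrite integral_indic//; last exact: mI.
  rewrite EFinM muleC lee_wpmul2r ?lee_fin//.
  apply: le_trans (Ih i); apply: le_measure; rewrite ?inE//.
  - by apply: measurableI => //; exact: mI.
  - exact: mI.
- move=> i; apply/measurable_EFinP; apply: measurable_funM => //.
  by apply: measurable_indic; exact: mI.
- by move=> i y _; rewrite lee_fin mulr_ge0.
Qed.

End pc_dens_integrals.

(** Interpolation between the variation of the densities and the uniform
    distance of their primitives: by [pc_dens_mean], replacing each density by
    its mean over [y, y + h] costs at most [h * V] in L^1, and these means are
    difference quotients of the primitives. *)
Lemma pc_dens_L1_dist {R : realType} {N N' : nat} (x : 'rV[R]_N.+1)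
    (x' : 'rV[R]_N'.+1) (V e h A : R) : in_K x -> in_K x' ->
  0 < h -> 0 <= A -> sum_jumps x <= V -> sum_jumps x' <= V ->
  (forall y : R, - A <= y <= A + h -> `|cdf x y - cdf x' y| <= e) ->
  (\int[@lebesgue_measure R]_(y in `[(- A)%R, A])
     `|pc_dens x y - pc_dens x' y|%:E <=
   (2 * A * (2 * e / h) + 2 * h * V)%:E)%E.
Proof.
move=> Kx Kx' h0 A0 xV x'V xx'.
pose W M (z : 'rV[R]_M.+1) (y : R) : R :=
  \sum_(i < M.+1) `|jump z i| * \1_(`]pos z i - h, pos z i[) y.
have W0 M (z : 'rV[R]_M.+1) y : 0 <= W M z y by apply: sumr_ge0 => i _; rewrite mulr_ge0.
have mW M (z : 'rV[R]_M.+1) (D : set R) : measurable_fun D (W M z).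
  apply: measurable_sum => i; apply: measurable_funM; first exact: measurable_cst.
  by apply: measurable_indic; exact: measurable_itv.
have e0 : 0 <= e by apply: le_trans (xx' A _) => //; apply/andP; split; lra.
have intW M (z : 'rV[R]_M.+1) : sum_jumps z <= V ->
    (\int[@lebesgue_measure R]_(y in `[(- A)%R, A]) (W M z y)%:E <= (h * V)%:E)%E.
  move=> zV; apply: (@le_trans _ _ (h * sum_jumps z)%:E); last first.
    by rewrite lee_fin ler_wpM2l// ltW.
  apply: (@integral_indic_sum_le _ _ (fun i => `|jump z i|)
    (fun i => `](pos z i - h), (pos z i)[%classic)) => // i.
  rewrite lebesgue_measure_itv/= lte_fin -EFinB; case: ifPn => _; rewrite lee_fin; lra.
have ptw y : y \in `[(- A), A] ->
    `|pc_dens x y - pc_dens x' y| <= 2 * e / h + W N x y + W N' x' y.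
  rewrite in_itv/= => /andP[Ay yA].
  rewrite -(ler_pM2l h0) -{1}(gtr0_norm h0) -normrM !mulrDr.
  rewrite mulrCA divff ?gt_eqF// mulr1.
  have := pc_dens_mean y Kx h0; have := pc_dens_mean y Kx' h0.
  rewrite -/(W N x y) -/(W N' x' y).
  have := xx' y; have := xx' (y + h).
  move=> /(_ _)/wrap[]; first by apply/andP; split; lra.
  move=> c1 /(_ _)/wrap[]; first by apply/andP; split; lra.
  move: c1; rewrite !ler_norml => /andP[? ?] /andP[? ?] /andP[? ?] /andP[? ?].
  by apply/andP; split; lra.
apply: (@le_trans _ _ (\int[@lebesgue_measure R]_(y in `[(- A)%R, A])
    ((2 * e / h)%:E + (W N x y)%:E + (W N' x' y)%:E))%E).
  apply: ge0_le_integral => //.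
  - apply/measurable_EFinP; apply: measurableT_comp => //.
    by apply: measurable_funB; exact: measurable_pc_dens.
  - apply: emeasurable_funD; last by apply/measurable_EFinP; exact: mW.
    by apply: emeasurable_funD => //; apply/measurable_EFinP; exact: mW.
have c0 : 0 <= 2 * e / h by rewrite !mulr_ge0// invr_ge0 ltW.
rewrite ge0_integralD//=.
- rewrite ge0_integralD//=.
  + rewrite integral_cst//= lebesgue_measure_itv/= lte_fin.
    have -> : 2 * A * (2 * e / h) + 2 * h * V =
      2 * e / h * (A - - A) + h * V + h * V by ring.
    rewrite !EFinD; apply: leeD; last exact: intW.
    apply: leeD; last exact: intW.
    by case: ifPn => _; rewrite ?EFinM ?EFinB// mule0 -EFinM lee_fin mulr_ge0; lra.
  + by move=> y _; rewrite lee_fin.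
  + by apply/measurable_EFinP; exact: mW.
- by move=> y _; rewrite -EFinD lee_fin addr_ge0.
- by apply: emeasurable_funD => //; apply/measurable_EFinP; exact: mW.
- by move=> y _; rewrite lee_fin.
- by apply/measurable_EFinP; exact: mW.
Qed.

(** * Test functions that detect the jumps *)

(** A quadratic remainder estimate treats the kink of [sqpos] like any other
    point. *)
Lemma is_derive_quadratic {R : realType} (f : R -> R) (y d C : R) :
  (forall h : R, `|f (y + h) - f y - h * d| <= C * h ^+ 2) -> is_derive y 1 f d.
Proof.
move=> fC.
have C0 : 0 <= C by have := fC 1; rewrite expr1n mulr1; exact: le_trans.
suff cvd : h^-1 *: ((f \o shift y) (h *: 1) - f y) @[h --> 0^'] --> d.
  by apply: DeriveDef; [apply/cvg_ex; exists d|exact: cvg_lim cvd].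
apply/cvgrPdist_le => e e0; near=> h.
have h0 : h != 0 by near: h; exact: nbhs_dnbhs_neq.
have -> : d - h^-1 *: ((f \o shift y) (h *: 1) - f y) =
    - (h^-1 * (f (y + h) - f y - h * d)).
  have -> : (f \o shift y) (h *: 1) = f (y + h).
    by rewrite /= [_ *: _]mulr1 addrC.
  by rewrite mulrBr mulrA mulVf// mul1r opprB.
rewrite normrN normrM normfV ler_pdivrMl ?normr_gt0//.
apply: (le_trans (fC h)).
have -> : C * h ^+ 2 = `|h| * (C * `|h|).
  by rewrite [RHS]mulrCA -normrM -expr2 ger0_norm ?sqr_ge0.
rewrite ler_wpM2l// (@le_trans _ _ ((C + 1) * `|h|))//.
  by rewrite ler_wpM2r// lerDl.
rewrite -ler_pdivlMl; last by rewrite ltr_wpDl.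
by near: h; apply: dnbhs0_le; rewrite mulr_gt0// invr_gt0 ltr_wpDl.
Unshelve. all: by end_near. Qed.

Section bump.
Context {R : realType}.

Definition sqpos (u : R) : R := (Num.max 0 u) ^+ 2.

Lemma is_derive_sqpos (a b y : R) :
  is_derive y 1 (fun z => sqpos (a * z + b)) (2 * a * Num.max 0 (a * y + b)).
Proof.
apply: (@is_derive_quadratic _ _ _ _ (a ^+ 2)) => h.
have -> : a * (y + h) + b = (a * y + b) + a * h by ring.
have -> : a ^+ 2 * h ^+ 2 = (a * h) ^+ 2 by ring.
have -> : forall m : R, h * (2 * a * m) = 2 * (a * h) * m by move=> m; ring.
move: (a * y + b) (a * h) => u k; rewrite /sqpos ler_norml.
case: (lerP 0 (u + k)) => h1; case: (lerP 0 u) => h2; apply/andP; split; nra.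
Qed.

(** A C^1 bump of height 1 centred at [c] and supported in [c - d, c + d]. *)
Definition bump (c d y : R) : R :=
  sqpos (- d^-1 * y + (1 + c / d)) * sqpos (d^-1 * y + (1 - c / d)).

Definition dbump (c d y : R) : R :=
  sqpos (- d^-1 * y + (1 + c / d)) *
    (2 * d^-1 * Num.max 0 (d^-1 * y + (1 - c / d))) +
  sqpos (d^-1 * y + (1 - c / d)) *
    (2 * (- d^-1) * Num.max 0 (- d^-1 * y + (1 + c / d))).

Lemma is_derive_bump (c d y : R) : is_derive y 1 (bump c d) (dbump c d y).
Proof.
exact: (is_deriveM (is_derive_sqpos _ _ _) (is_derive_sqpos _ _ _)).
Qed.

Lemma continuous_dbump (c d : R) : continuous (dbump c d).
Proof.
have cp (a b : R) : continuous (fun y => Num.max 0 (a * y + b)).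
  have -> : (fun y => Num.max 0 (a * y + b)) =
    (fun y => (a * y + b + `|a * y + b|) / 2).
    by apply/funext => y; rewrite maxr_absE add0r sub0r normrN.
  move=> y; apply: cvgM; last exact: cvg_cst.
  have cab : a * z + b @[z --> y] --> a * y + b.
    apply: cvgD; last exact: cvg_cst.
    by apply: cvgM; [exact: cvg_cst|exact: cvg_id].
  by apply: cvgD => //; apply: cvg_norm.
have cs (a b : R) : continuous (fun y => sqpos (a * y + b)).
  by move=> y; rewrite /sqpos; apply: cvgM; exact: cp.
have cm (k a b : R) : continuous (fun y => k * Num.max 0 (a * y + b)).
  by move=> y; apply: cvgM; [exact: cvg_cst|exact: cp].
by move=> y; apply: cvgD; apply: cvgM; (exact: cs || exact: cm).
Qed.

Lemma bump_center (c d : R) : 0 < d -> bump c d c = 1.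
Proof.
move=> d0; rewrite /bump /sqpos.
have -> : - d^-1 * c + (1 + c / d) = 1 by ring.
have -> : d^-1 * c + (1 - c / d) = 1 by ring.
by rewrite max_r// !expr1n mulr1.
Qed.

Lemma bump_ge0 (c d y : R) : 0 <= bump c d y.
Proof. by rewrite mulr_ge0// sqr_ge0. Qed.

Lemma bump_le1 (c d y : R) : bump c d y <= 1.
Proof.
rewrite /bump.
have -> : - d^-1 * y + (1 + c / d) = 1 - (y - c) / d by ring.
have -> : d^-1 * y + (1 - c / d) = 1 + (y - c) / d by ring.
move: ((y - c) / d) => z; rewrite /sqpos -exprMn expr_le1//.
  by case: (lerP 0 (1 - z)) => ?; case: (lerP 0 (1 + z)) => ?; nra.
by rewrite mulr_ge0// le_max lexx.
Qed.

Lemma bump_out (c d y : R) : 0 < d -> d <= `|y - c| -> bump c d y = 0.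
Proof.
move=> d0 yc; rewrite /bump.
have -> : - d^-1 * y + (1 + c / d) = 1 - (y - c) / d by ring.
have -> : d^-1 * y + (1 - c / d) = 1 + (y - c) / d by ring.
have : 1 <= `|(y - c) / d|.
  by rewrite normrM normfV (gtr0_norm d0) ler_pdivlMr// mul1r.
rewrite /sqpos; case: (lerP 0 ((y - c) / d)) => h.
  rewrite ger0_norm// => h1; rewrite [Num.max 0 (1 - _)]max_l ?subr_le0//.
  by rewrite expr0n mul0r.
rewrite ltr0_norm// => h1; rewrite [Num.max 0 (1 + (y - c) / d)]max_l;
  last by move: h1; lra.
by rewrite expr0n mulr0.
Qed.

End bump.

(** Bumps with disjoint supports can be given any signs without their sum
    exceeding 1 in absolute value. *)
Lemma test_fun_bumps {R : realType} (n : nat) (p : nat -> R) (d : R)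
    (s : nat -> bool) : 0 < d ->
  (forall i j, (i < j)%N -> (j < n)%N -> 2 * d <= p j - p i) ->
  exists2 phi : R -> R, test_fun phi &
    forall i, (i < n)%N -> phi (p i) = (-1) ^+ s i.
Proof.
move=> d0 pd; pose phi (y : R) : R := \sum_(i < n) (-1) ^+ s i * bump (p i) d y.
have gap i j : (i < n)%N -> (j < n)%N -> i != j -> 2 * d <= `|p i - p j|.
  move=> iN jN; rewrite neq_ltn => /orP[ij|ji].
    by rewrite distrC (le_trans (pd _ _ ij jN))// ler_norm.
  by rewrite (le_trans (pd _ _ ji iN))// ler_norm.
have single i (y : R) : (i < n)%N -> `|y - p i| < d ->
    phi y = (-1) ^+ s i * bump (p i) d y.
  move=> iN yi; rewrite /phi (bigD1 (Ordinal iN))//= big1 ?addr0// => j ji.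
  rewrite bump_out ?mulr0//.
  have := gap _ _ (ltn_ord j) iN ji.
  have : `|p j - p i| <= `|y - p i| + `|y - p j|.
    by have := ler_distD y (p i) (p j); rewrite distrC [`|p i - y|]distrC.
  lra.
exists phi; last first.
  move=> i iN; rewrite (single i)// ?subrr ?normr0//.
  by rewrite bump_center// mulr1.
have dphi (y : R) : is_derive y 1 phi
    (\sum_(i < n) (-1) ^+ s i * dbump (p i) d y).
  have -> : phi = \sum_(i < n) (fun z => (-1) ^+ s i * bump (p i) d z).
    by apply/funext => z; rewrite fct_sumE.
  by apply: is_derive_sum => i; apply: is_deriveZ; exact: is_derive_bump.
split.
- by move=> y; have [] := dphi y.
- have -> : derive1 phi = fun y => \sum_(i < n) (-1) ^+ s i * dbump (p i) d y.
    by apply/funext => y; rewrite derive1E; have [] := dphi y.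
  move=> y; apply: cvg_big => [|i _]; first by move=> x; exact: add_continuous.
  by apply: cvgM; [exact: cvg_cst|exact: continuous_dbump].
- pose B := \sum_(i < n) (`|p i| + d).
  apply: (@subclosed_compact _ _ `[- B, B]); first exact: closed_closure.
    exact: segment_compact.
  rewrite [X in _ `<=` X](_ : _ = closure `[- B, B]); last first.
    by apply/closure_id; exact: itv_closed.
  apply: closureS => y /=; apply: contraNP => yB.
  apply/eqP; rewrite /phi big1// => i _; rewrite bump_out ?mulr0//.
  have iB : `|p i| + d <= B.
    by rewrite /B (bigD1 i)//= lerDl sumr_ge0// => j _; rewrite addr_ge0// ltW.
  have By : B < `|y|.
    rewrite ltNge; apply/negP => yB'; apply: yB; rewrite in_itv/=.
    by rewrite -ler_norml.
  have := ler_normD (y - p i) (p i); rewrite subrK; lra.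
- move=> y; have [[i /andP[iN yi]]|far] :=
    pselect (exists i, (i < n)%N && (`|y - p i| < d)).
    rewrite (single i)// normrM normr_sign mul1r ger0_norm ?bump_ge0//.
    exact: bump_le1.
  rewrite /phi big1 ?normr0// => i _; rewrite bump_out ?mulr0// leNgt.
  by apply/negP => yi; apply: far; exists i; rewrite ltn_ord.
Qed.

(** Conversely to [tot_var_pc_dens_le]: a test function that takes the value
    -1 at the upward jumps and 1 at the downward ones realises the sum of the
    jumps. The width of the bumps comes from the lower bound [1 / (N * V)] for
    the distance between neighbours, with [V] the sum of the jumps. *)
Lemma sum_jumps_le_tot_var {R : realType} {N : nat} (x : 'rV[R]_N.+1) :
  in_K x -> (0 < N)%N -> ((sum_jumps x)%:E <= tot_var (pc_dens x))%E.
Proof.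
move=> Kx N0; pose d : R := (2 * N%:R * sum_jumps x)^-1.
have V0 : 0 < sum_jumps x.
  by apply: lt_le_trans (dens_le_sum_jumps x N0); exact: dens_gt0.
have d0 : 0 < d by rewrite invr_gt0 !mulr_gt0// ltr0n.
have pd i j : (i < j)%N -> (j < N.+1)%N -> 2 * d <= pos x j - pos x i.
  move=> ij jN; have iN := leq_trans ij jN.
  apply: (@le_trans _ _ (pos x i.+1 - pos x i)); last first.
    by rewrite lerD2r pos_le.
  have r0 := dens_gt0 Kx iN.
  have -> : 2 * d = N%:R^-1 / sum_jumps x.
    by rewrite /d; field; rewrite gt_eqF//= pnatr_eq0 -lt0n.
  rewrite -(ler_pM2l r0) dens_mass// mulrCA ler_piMr ?invr_ge0//.
  by rewrite ler_pdivrMr// mul1r dens_le_sum_jumps.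
have [phi phit phip] := test_fun_bumps (fun i => 0 < jump x i) d0 pd.
apply: le_trans (ereal_sup_ubound _); last by exists phi.
have [dphi cphi _ _] := phit.
rewrite integral_pc_dens_derive1// lee_fin -sumrN; apply: ler_sum => i _.
rewrite phip//; case: ltP => h.
  by rewrite expr1 mulrN1 opprK gtr0_norm.
by rewrite expr0 mulr1 ler0_norm.
Qed.

(** * Transport of mass between two configurations *)

Section transport.
Context {R : realType}.
Local Notation mu := (@lebesgue_measure R).
Implicit Types phi psi : R -> R.

Lemma continuous_affine (a b : R) : continuous (fun t : R => a + t * (b - a)).
Proof.
move=> t; apply: cvgD; first exact: cvg_cst.
by apply: cvgM; [exact: cvg_id|exact: cvg_cst].
Qed.

Lemma integral_affine phi (a b : R) : a < b -> continuous phi ->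
  (\int[mu]_(y in `[a, b]) (phi y)%:E =
   (b - a)%:E * \int[mu]_(t in `[0%R, 1%R]) (phi (a + t * (b - a)))%:E)%E.
Proof.
move=> ab cphi; pose F (t : R) : R := a + t * (b - a).
have dF (t : R) : is_derive t 1 F (b - a).
  rewrite -[b - a]add0r; apply: is_deriveD.
  rewrite -[X in is_derive _ _ _ X]mul1r.
  have := is_deriveM (is_derive_id t (1:R)) (is_derive_cst (b - a) t (1:R)).
  by move=> h; apply: is_derive_eq h _; rewrite /= scaler0 add0r [_ *: _]mulr1 mul1r.
have dFE : derive1 F = cst (b - a).
  by apply/funext => t; rewrite derive1E; have [] := dF t.
have cF : continuous F by exact: continuous_affine.
have F0 : F 0 = a by rewrite /F mul0r addr0.
have F1 : F 1 = b by rewrite /F; ring.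
rewrite -{1}F0 -{1}F1 (@integration_by_substitution_increasing _ F phi)//.
- rewrite dFE -integralZl//.
  + by apply: eq_integral => t _; rewrite /= EFinM muleC.
  + apply: (@continuous_segment_integrable _ (phi \o F)) => t.
    by apply: continuous_comp; [exact: cF|exact: cphi].
- move=> s t _ _ st; rewrite /F ltrD2l ltr_pM2r//; lra.
- by rewrite dFE => t _; exact: cst_continuous.
- by rewrite dFE; exact: is_cvg_cst.
- by rewrite dFE; exact: is_cvg_cst.
- split.
  + by move=> t _; have [] := dF t.
  + by apply: cvg_at_right_filter; exact: cF.
  + by apply: cvg_at_left_filter; exact: cF.
- exact: continuous_subspaceT.
Qed.

(** Parametrising each cell by its mass fraction gives a coupling of the two
    densities that moves every unit of mass by at most [d]. *)
Lemma pc_dens_transport {N : nat} (x x' : 'rV[R]_N.+1) (d : R) phi psi :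
  in_K x -> in_K x' -> continuous phi -> continuous psi ->
  (forall i, (i <= N)%N -> `|pos x i - pos x' i| <= d) ->
  (forall y y' : R, `|y - y'| <= d -> phi y <= psi y') ->
  (\int[mu]_y (pc_dens x y * phi y)%:E <=
   \int[mu]_y (pc_dens x' y * psi y)%:E)%E.
Proof.
move=> Kx Kx' cphi cpsi xx' phipsi.
rewrite !integral_pc_dens//; apply: lee_sum => i _.
have iN := ltn_ord i.
rewrite (integral_affine (posS Kx iN) cphi) (integral_affine (posS Kx' iN) cpsi).
rewrite !muleA -!EFinM !dens_mass//.
rewrite lee_pmul2l ?lte_fin ?invr_gt0 ?ltr0n ?(leq_ltn_trans _ iN)//.
apply: le_integral => //.
- apply: (@continuous_segment_integrable _ (phi \o _)) => t.
  by apply: continuous_comp; [exact: continuous_affine|exact: cphi].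
- apply: (@continuous_segment_integrable _ (psi \o _)) => t.
  by apply: continuous_comp; [exact: continuous_affine|exact: cpsi].
move=> t; rewrite inE/= in_itv/= => /andP[t0 t1].
rewrite lee_fin phipsi//.
move: (xx' _ iN) (xx' _ (ltnW iN)); rewrite !ler_norml.
move: (pos x i.+1) (pos x i) (pos x' i.+1) (pos x' i).
move=> b a b' a' /andP[h1 h2] /andP[h3 h4].
have -> : a + t * (b - a) - (a' + t * (b' - a')) =
  (1 - t) * (a - a') + t * (b - b') by ring.
have -> : d = (1 - t) * d + t * d by ring.
rewrite opprD -!mulrN; apply/andP; split.
  by apply: lerD; apply: ler_wpM2l; lra.
by apply: lerD; apply: ler_wpM2l; lra.
Qed.

End transport.

(** * Compactness of equi-Lipschitz families *)

(** The Arzela-Ascoli theorem provides a cluster point of the sequence for the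
    uniform convergence on compact sets, of which [Q] is one. *)
Lemma equilipschitz_cluster {R : realType} (f : nat -> R * R -> R) (C : R)
    (Q : set (R * R)) : compact Q ->
  (forall n p, 0 <= f n p <= 1) ->
  (forall n p q, `|f n p - f n q| <= C * (`|p.1 - q.1| + `|p.2 - q.2|)) ->
  exists g : R * R -> R, forall (e : R) n0, 0 < e ->
    exists2 n, (n0 <= n)%N & forall p, Q p -> `|f n p - g p| <= e.
Proof.
move=> cQ f01 flip.
pose W : set {family compact, R * R -> R} := range f.
have pcW : precompact W.
  apply: pointwise_precompact_equicontinuous.
  - exact: Rhausdorff.
  - move=> p; exists `[0, 1]%classic; last first.
      by split; [exact: segment_compact|exact: itv_closed].
    by move=> _ [_ [n _ <-] <-] /=; rewrite in_itv/= f01.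
  move=> p E; rewrite -entourage_ballE => -[e e0 eE].
  have d0 : 0 < e / (2 * (`|C| + 1)).
    by rewrite divr_gt0// mulr_gt0// ltr_wpDl.
  have : nbhs p (ball p (e / (2 * (`|C| + 1)))) by exact: nbhsx_ballx.
  apply: filterS => q [/= q1 q2] h [n _ <-]; apply: eE => /=.
  apply: le_lt_trans (flip _ _ _) _.
  have C1 : 0 < `|C| + 1 by rewrite ltr_wpDl.
  have := ler_norm C => CC.
  apply: (@le_lt_trans _ _ ((`|C| + 1) * (`|p.1 - q.1| + `|p.2 - q.2|))).
    by rewrite ler_wpM2r ?addr_ge0//; lra.
  have -> : e = (`|C| + 1) * (e / (2 * (`|C| + 1)) + e / (2 * (`|C| + 1))).
    by field; rewrite gt_eqF.
  by rewrite ltr_pM2l// ltrD.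
have : compact (closure W) by rewrite -precompactE.
have fF : ProperFilter (f @ \oo) by exact: fmap_proper_filter.
move=> /(_ (f @ \oo) _)[].
  by exists 0%N => // n _; apply: subset_closure; exists n.
move=> g [_ cg]; exists g => e n0 e0.
have entE : entourage [set xy : R * R | ball xy.1 e xy.2].
  by rewrite -entourage_ballE; exists e.
have tail : (f @ \oo) [set h | exists2 n, (n0 <= n)%N & h = f n].
  by exists n0 => // n /= n0n; exists n.
have [h [[n n0n ->] gf]] := cg _ _ tail (fam_nbhs g entE cQ).
by exists n => // p Qp; rewrite distrC ltW//; exact: (gf p Qp).
Qed.

Lemma subsequence_choice (P : nat -> nat -> Prop) :
  (forall k n, exists2 m, (n <= m)%N & P k m) ->
  exists2 psi : nat -> nat, increasing_seq psi & forall k, P k (psi k).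
Proof.
move=> PP.
have /choice[c cP] : forall kn : nat * nat, exists m, (kn.2 <= m)%N /\ P kn.1 m.
  by move=> [k n]; have [m nm Pm] := PP k n; exists m.
pose psi := fix psi k := if k is k'.+1 then c (k, (psi k').+1) else c (0, 0)%N.
exists psi; last first.
  by case=> [|k]; [have [] := cP (0, 0)%N|have [] := cP (k.+1, (psi k).+1)].
by apply/increasing_seqP => k; have [] := cP (k.+1, (psi k).+1).
Qed.

Section L1_limit.
Context {R : realType}.
Local Notation mu := (@lebesgue_measure R).

(** The sum of the increments controls the distance to the limit; when it is
    infinite there is nothing to prove, whatever the upper limit is. *)
Lemma dist_limn_esup (u : nat -> R) (n : nat) :
  (`|u n - fine (limn_esup (EFin \o u))|%:E <=
   \sum_(k <oo) `|u (n + k)%N - u (n + k).+1|%:E)%E.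
Proof.
pose w k := u (n + k).+1 - u (n + k)%N.
have wE k : `|u (n + k)%N - u (n + k).+1|%:E = `|w k|%:E by rewrite distrC.
rewrite (eq_eseriesr (fun k _ => wE k)).
have partial m : ((\sum_(0 <= k < m) `|w k|)%:E <= \sum_(k <oo) `|w k|%:E)%E.
  by rewrite -sumEFin; apply: nneseries_lim_ge => // k _ _; rewrite lee_fin.
have tel m : u (n + m)%N = u n + series w m.
  rewrite /series /=.
  have -> : \sum_(0 <= k < m) w k = u (n + m)%N - u (n + 0)%N.
    rewrite -(telescope_sumr (fun k => u (n + k)%N))//.
    by apply: eq_bigr => k _; rewrite /w addnS.
  by rewrite addn0 addrC subrK.
case: (\sum_(k <oo) _)%E partial => [t|_|/(_ 0%N)]; last 2 first.
- exact: leey.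
- by rewrite leeNy_eq.
move=> partial.
have cw : cvgn (series w).
  apply: normed_cvg; apply: nondecreasing_is_cvgn.
    apply/nondecreasing_seqP => m; rewrite /= !seriesEnat/= big_nat_recr//= lerDl.
    exact: normr_ge0.
  by exists t => _ [m _ <-]; have := partial m; rewrite lee_fin /= seriesEnat.
have [l ul] : exists l : R, u @ \oo --> l.
  exists (u n + limn (series w)).
  rewrite -(cvg_shiftn n); under eq_fun do rewrite addnC tel.
  by apply: cvgD; [exact: cvg_cst|].
have -> : fine (limn_esup (EFin \o u)) = l.
  have ul' : (EFin \o u) @ \oo --> l%:E.
    by apply: cvg_EFin; [exact: nearW|exact: ul].
  by rewrite (cvg_limn_einf_sup ul').2.
rewrite lee_fin.
have ul' : `|u n - u (n + m)%N| @[m --> \oo] --> `|u n - l|.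
  apply: cvg_norm; apply: cvgB; first exact: cvg_cst.
  under eq_fun do rewrite addnC.
  have : [sequence u (m + n)%N]_m @ \oo --> l by rewrite cvg_shiftn.
  exact.
rewrite -(cvg_lim _ ul')//; apply: limr_le; first by apply/cvg_ex; eexists; exact: ul'.
apply: nearW => m; rewrite tel opprD addNKr normrN.
have := partial m; rewrite lee_fin; apply: le_trans.
exact: ler_norm_sum.
Qed.

Lemma measurable_fine_limn_esup (g : nat -> R -> R) :
  (forall n, measurable_fun setT (g n)) ->
  measurable_fun setT (fun x => fine (limn_esup (fun k => (g k x)%:E))).
Proof.
move=> mg; apply: (@measurableT_comp _ _ _ _ _ _ fine) => //.
by apply: measurable_fun_limn_esup => k; apply/measurable_EFinP; exact: mg.
Qed.

(** The limit is given by a formula rather than by choice, so that it can be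
    used at all times simultaneously. *)
Lemma L1_geometric_limit (K : set R) (g : nat -> R -> R) (C : R) :
  measurable K -> (forall n, measurable_fun setT (g n)) ->
  (forall n, (\int[mu]_(x in K) `|g n x - g n.+1 x|%:E <=
     (C / (2 ^ n.+1)%:R)%:E)%E) ->
  forall n, (\int[mu]_(x in K)
    `|g n x - fine (limn_esup (fun k => (g k x)%:E))|%:E <= (C / 2 ^+ n)%:E)%E.
Proof.
move=> mK mg gC n.
have md k l : measurable_fun K (fun x => `|g k x - g l x|%:E).
  apply/measurable_EFinP; apply: measurableT_comp => //; apply: measurable_funTS.
  exact: measurable_funB.
have -> : (C / 2 ^+ n)%:E = (\sum_(k <oo) (C / (2 ^ (k + n.+1))%:R)%:E)%E.
  by rewrite -(cvg_lim _ (@cvg_geometric_eseries_half R C n)).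
apply: (@le_trans _ _ (\int[mu]_(x in K)
    \sum_(k <oo) `|g (n + k)%N x - g (n + k).+1 x|%:E)%E).
  apply: ge0_le_integral => //.
  - apply/measurable_EFinP; apply: measurableT_comp => //; apply: measurable_funB.
      by apply: measurable_funTS; exact: mg.
    apply: measurable_funTS; exact: measurable_fine_limn_esup.
  - by apply: ge0_emeasurable_sum => // k _; exact: md.
  - by move=> x _; exact: (dist_limn_esup (fun k => g k x)).
rewrite integral_nneseries//; last by move=> k; exact: md.
apply: lee_nneseries => [k _ _|k _]; first exact: integral_ge0.
by rewrite addnS [(k + n)%N]addnC; exact: gC.
Qed.

End L1_limit.

(** * L^1 distances *)

Section L1_tools.
Context {R : realType}.
Local Notation mu := (@lebesgue_measure R).

Lemma cvge0_le {T : Type} (F : set_system T) (u : T -> \bar R) : Filter F ->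
  (forall x, (0 <= u x)%E) ->
  (forall e : R, 0 < e -> \forall x \near F, (u x <= e%:E)%E) ->
  u @ F --> 0%E.
Proof.
move=> FF u0 ule; apply/fine_cvgP; split.
  have := ule 1 ltr01; apply: filterS => x ux.
  by rewrite ge0_fin_numE// (le_lt_trans ux)// ltry.
apply/cvgrPdist_le => e e0; have := ule e e0; apply: filterS => x ux.
rewrite sub0r normrN ger0_norm ?fine_ge0//=.
by rewrite -lee_fin fineK// ge0_fin_numE// (le_lt_trans ux)// ltry.
Qed.

Lemma measurable_dist (D : set R) (f g : R -> R) :
  measurable_fun setT f -> measurable_fun setT g ->
  measurable_fun D (fun x => `|f x - g x|%:E).
Proof.
move=> mf mg; apply/measurable_EFinP; apply: measurableT_comp => //.
by apply: measurable_funTS; exact: measurable_funB.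
Qed.

Lemma L1_triangle (D : set R) (f g h : R -> R) : measurable D ->
  measurable_fun setT f -> measurable_fun setT g -> measurable_fun setT h ->
  (\int[mu]_(x in D) `|f x - h x|%:E <=
   \int[mu]_(x in D) `|f x - g x|%:E + \int[mu]_(x in D) `|g x - h x|%:E)%E.
Proof.
move=> mD mf mg mh; rewrite -ge0_integralD//; last 2 first.
- exact: measurable_dist.
- exact: measurable_dist.
apply: ge0_le_integral => //.
- exact: measurable_dist.
- by apply: emeasurable_funD; exact: measurable_dist.
- by move=> x _; rewrite -EFinD lee_fin ler_distD.
Qed.

Lemma L1_dist_sym (D : set R) (f g : R -> R) :
  (\int[mu]_(x in D) `|f x - g x|%:E = \int[mu]_(x in D) `|g x - f x|%:E)%E.
Proof. by apply: eq_integral => x _; rewrite distrC. Qed.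

Lemma L1_dist_subset (D D' : set R) (f g : R -> R) : measurable D ->
  measurable D' -> D `<=` D' ->
  measurable_fun setT f -> measurable_fun setT g ->
  (\int[mu]_(x in D) `|f x - g x|%:E <= \int[mu]_(x in D') `|f x - g x|%:E)%E.
Proof.
move=> mD mD' DD' mf mg; apply: ge0_subset_integral => //.
exact: measurable_dist.
Qed.

Lemma L1_dist_support (D : set R) (f g : R -> R) : measurable D ->
  (forall x, ~ D x -> f x = 0) -> (forall x, ~ D x -> g x = 0) ->
  (\int[mu]_x `|f x - g x|%:E = \int[mu]_(x in D) `|f x - g x|%:E)%E.
Proof.
move=> mD f0 g0; rewrite [RHS]integral_mkcond; apply: eq_integral => x _.
rewrite patchE; case: ifPn => //; rewrite notin_setE => Dx.
by rewrite f0// g0// subrr normr0.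
Qed.

Lemma compact_sub_segment (K : set R) : compact K ->
  exists2 A : R, 0 < A & K `<=` `[- A, A].
Proof.
move=> /compact_bounded[M [_ KM]]; exists (`|M| + 1).
  by rewrite ltr_wpDl.
have M1 : M < `|M| + 1 by rewrite (le_lt_trans (ler_norm _))// ltrDl.
by move=> x Kx; rewrite /= in_itv/= -ler_norml; exact: KM M1 _ Kx.
Qed.

End L1_tools.

(** * Particle flows with uniform bounds *)

(** The only features of the Follow-the-Leader dynamics that the compactness
    argument relies on, with constants independent of the number of particles. *)
Definition tame_flow {R : realType} (V L : R) {N : nat}
    (X : R -> 'rV[R]_N.+1) : Prop :=
  [/\ forall t : R, 0 <= t -> in_K (X t),
      forall t : R, 0 <= t -> sum_jumps (X t) <= V &
      forall (i : nat) (s t : R), (i <= N)%N -> 0 <= s -> 0 <= t ->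
        `|pos (X t) i - pos (X s) i| <= L * `|t - s|].

Section tame_flows.
Context {R : realType} (V L : R).
Local Notation mu := (@lebesgue_measure R).

Section one_flow.
Context {N : nat} (X : R -> 'rV[R]_N.+1) (tX : tame_flow V L X).

Let V0 : 0 <= V.
Proof.
case: tX => _ h _; apply: le_trans (h 0 (lexx _)); exact: sum_jumps_ge0.
Qed.

Let L0 : 0 <= L.
Proof.
case: tX => _ _ /(_ 0%N 0 1 isT (lexx _) ler01).
by rewrite subr0 normr1 mulr1; exact: le_trans.
Qed.

Lemma tame_cdf_lipschitz (s t y z : R) : 0 <= s -> 0 <= t ->
  `|cdf (X s) y - cdf (X t) z| <= (2 * V * L + V) * (`|s - t| + `|y - z|).
Proof.
move=> s0 t0; have [KX XV XL] := tX.
rewrite (le_trans (ler_distD (cdf (X s) z) _ _))//.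
have h1 : `|cdf (X s) y - cdf (X s) z| <= V * `|y - z|.
  by rewrite (le_trans (cdf_lipschitz _ _ (KX s s0)))// ler_wpM2r// XV.
have h2 : `|cdf (X s) z - cdf (X t) z| <= V * (L * `|s - t|) + V * (L * `|s - t|).
  have Lst : 0 <= L * `|s - t| by rewrite mulr_ge0.
  have := cdf_dist z (KX s s0) (KX t t0) (fun i iN => XL i t s iN t0 s0).
  move=> /le_trans; apply.
  by apply: lerD; rewrite ler_wpM2r// XV.
have := mulr_ge0 V0 (normr_ge0 (s - t)).
have := mulr_ge0 (mulr_ge0 V0 L0) (normr_ge0 (y - z)).
move: h1 h2; rewrite mulrDl !mulrDr; nra.
Qed.

Lemma tame_L1_equicontinuous (s t h A : R) : 0 <= s -> 0 <= t -> 0 < h ->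
  0 <= A ->
  (\int[mu]_(y in `[(- A)%R, A]) `|pc_dens (X s) y - pc_dens (X t) y|%:E <=
   (2 * A * (2 * ((2 * V * L + V) * `|s - t|) / h) + 2 * h * V)%:E)%E.
Proof.
move=> s0 t0 h0 A0; have [KX XV XL] := tX.
apply: pc_dens_L1_dist => //; try exact: KX; try exact: XV.
move=> y _; apply: (le_trans (tame_cdf_lipschitz y y s0 t0)).
by rewrite subrr normr0 addr0.
Qed.

(** The finite speed of propagation keeps the supports in a fixed segment, so
    that [tame_L1_equicontinuous], with first [h] and then [|s - t|] small,
    gives continuity in L^1 of the whole line. *)
Lemma tame_in_CL1 (T : R) : in_CL1 T (fun t => pc_dens (X t)).
Proof.
have [KX XV XL] := tX.
move=> t tT; have /andP[t0 tT'] := tT; split.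
  by apply/Lfun1_integrable; apply: integrable_pc_dens => //; exact: KX.
pose A := `|pos (X 0) 0| + `|pos (X 0) N| + L * T.
have A0 : 0 <= A by rewrite !addr_ge0// mulr_ge0// (le_trans t0).
have supp (s : R) : 0 <= s <= T ->
    forall y, ~ (`[- A, A]%classic y) -> pc_dens (X s) y = 0.
  move=> /andP[s0 sT] y /negP yA; apply: pc_dens_out; first exact: KX.
  have LsT : L * `|s - 0| <= L * T by rewrite subr0 ger0_norm// ler_wpM2l.
  have := XL 0%N 0 s isT (lexx _) s0; have := XL N 0 s (leqnn _) (lexx _) s0.
  have := ler_norm (pos (X 0) N); have := ler_norm (- pos (X 0) 0).
  have := normr_ge0 (pos (X 0) N); have := normr_ge0 (pos (X 0) 0).
  rewrite normrN !ler_norml => b1 b2 b3 b4 /andP[b5 b6] /andP[b7 b8].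
  move: yA; rewrite /= in_itv/= negb_and -!ltNge => /orP[yA|yA].
    by apply/orP; left; move: yA; rewrite /A; lra.
  by apply/orP; right; move: yA; rewrite /A; lra.
apply: cvge0_le => [s|e e0]; first exact: integral_ge0.
pose h := e / (2 * (2 * V + 1)).
have h0 : 0 < h by rewrite divr_gt0// mulr_gt0// ltr_wpDl// mulr_ge0.
pose k := 2 * A * (2 * (2 * V * L + V) / h).
have k0 : 0 <= k.
  have c0 : 0 <= 2 * V * L + V by rewrite addr_ge0 ?mulr_ge0.
  apply: mulr_ge0; first exact: mulr_ge0.
  by apply: divr_ge0; [exact: mulr_ge0|exact: ltW].
have d0 : 0 < e / (2 * (k + 1)) by rewrite divr_gt0// mulr_gt0// ltr_wpDl.
have : nbhs t (ball t (e / (2 * (k + 1)))) by exact: nbhsx_ballx.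
apply: filterS => s st sT; have /andP[s0 _] : 0 <= s <= T by [].
rewrite (@L1_dist_support _ `[- A, A])//; [|exact: supp|exact: supp].
apply: (le_trans (tame_L1_equicontinuous s0 t0 h0 A0)).
rewrite lee_fin.
have -> : 2 * A * (2 * ((2 * V * L + V) * `|s - t|) / h) = k * `|s - t|.
  by rewrite /k; ring.
have b1 : k * `|s - t| <= e / 2.
  rewrite (@le_trans _ _ ((k + 1) * `|s - t|))//.
    by rewrite ler_wpM2r// lerDl.
  have -> : e / 2 = (k + 1) * (e / (2 * (k + 1))).
    by field; rewrite gt_eqF// ltr_wpDl.
  rewrite ler_wpM2l ?addr_ge0// ltW// distrC; exact: st.
have b2 : 2 * h * V <= e / 2.
  have W0 : 0 < 2 * V + 1 by rewrite ltr_wpDl// mulr_ge0.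
  have -> : 2 * h * V = e / 2 * (2 * V / (2 * V + 1)).
    by rewrite /h; field; rewrite gt_eqF.
  by rewrite ler_piMr ?divr_ge0 ?(ltW e0)// ler_pdivrMr// mul1r lerDl.
lra.
Qed.

End one_flow.
End tame_flows.

(** * Relative compactness of the densities *)

Section compactness.
Context {R : realType} (V L : R) (X : forall N : nat, R -> 'rV[R]_N.+1).
Hypothesis tX : forall N, (0 < N)%N -> tame_flow V L (X N).
Local Notation mu := (@lebesgue_measure R).
Let rhoN (N : nat) (t : R) : R -> R := pc_dens (X N t).

Let mrho N t : measurable_fun setT (rhoN N t).
Proof. exact: measurable_pc_dens. Qed.

(** The primitives are uniformly Lipschitz, so they have a uniformly convergent
    subsequence; choosing the mollification length [2 ^- k] against the uniform
    error [4 ^- k] in [pc_dens_L1_dist] makes the densities a geometric Cauchy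
    sequence in L^1, uniformly in time. *)
Lemma geometric_subsequence (phi : nat -> nat) (T A : R) :
  (forall n, (0 < phi n)%N) -> 0 <= A ->
  exists2 psi : nat -> nat, increasing_seq psi &
  exists C : R, forall (k : nat) (t : R), 0 <= t <= T ->
    (\int[mu]_(x in `[(- A)%R, A])
       `|rhoN (phi (psi k)) t x - rhoN (phi (psi k.+1)) t x|%:E <=
     (C / (2 ^ k.+1)%:R)%:E)%E.
Proof.
move=> phi0 A0.
pose F n (p : R * R) : R := cdf (X (phi n) (Num.max 0 p.1)) p.2.
have max0 (t : R) : 0 <= Num.max 0 t by rewrite le_max lexx.
pose Q : set (R * R) := `[0, T] `*` `[- A, A + 1].
have cQ : compact Q by apply: compact_setX; exact: segment_compact.
have [|n p q|g gP] := @equilipschitz_cluster R F (2 * V * `|L| + V) Q cQ.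
- move=> n p; have [KX _ _] := tX (phi0 n).
  by rewrite /F cdf_ge0 ?cdf_le1//; exact: KX.
- have [KX XV _] := tX (phi0 n).
  have V0 : 0 <= V by apply: le_trans (XV 0 (lexx _)); exact: sum_jumps_ge0.
  apply: (le_trans (tame_cdf_lipschitz (tX (phi0 n)) _ _ (max0 _) (max0 _))).
  apply: (@le_trans _ _ ((2 * V * `|L| + V) *
      (`|Num.max 0 p.1 - Num.max 0 q.1| + `|p.2 - q.2|))).
    by rewrite ler_wpM2r ?addr_ge0// lerD2r ler_wpM2l ?mulr_ge0// ler_norm.
  rewrite ler_wpM2l ?addr_ge0 ?mulr_ge0// lerD2r.
  move: p.1 q.1 => a b; rewrite ler_norml.
  have := ler_norm (a - b); have := ler_norm (b - a); rewrite (distrC b).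
  by case: (lerP 0 a) => ?; case: (lerP 0 b) => ? ? ?; apply/andP; split; lra.
have [|psi psi_incr psiP] := @subsequence_choice
    (fun k n => forall p, Q p -> `|F n p - g p| <= (2 ^+ k)^-1 ^+ 2).
  by move=> k n; apply: gP; rewrite exprn_gt0// invr_gt0 exprn_gt0.
exists psi => //; exists (2 * (8 * A + 2 * V)) => k t tT.
have /andP[t0 _] := tT.
pose h : R := (2 ^+ k)^-1.
have h0 : 0 < h by rewrite invr_gt0 exprn_gt0.
have h1 : h <= 1 by rewrite invf_le1 ?exprn_gt0// exprn_ege1// ler1n.
have [K1 V1 _] := tX (phi0 (psi k)); have [K2 V2 _] := tX (phi0 (psi k.+1)).
apply: (@le_trans _ _ (2 * A * (2 * (2 * h ^+ 2) / h) + 2 * h * V)%:E).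
  rewrite /rhoN.
  apply: pc_dens_L1_dist => //; [exact: K1|exact: K2|exact: V1|exact: V2|].
  move=> y /andP[Ay yA].
  have Qy : Q (t, y).
    split => /=; rewrite in_itv//= Ay (le_trans yA)// lerD2l//.
  have := psiP k _ Qy; have := psiP k.+1 _ Qy.
  rewrite /F /= max_r// => e1 e2.
  have e3 : (2 ^+ k.+1)^-1 ^+ 2 <= h ^+ 2.
    rewrite lerXn2r// ?nnegrE ?invr_ge0 ?exprn_ge0// lef_pV2 ?posrE ?exprn_gt0//.
    by rewrite ler_weXn2l// ler1n.
  have := ler_distD (g (t, y)) (cdf (X (phi (psi k)) t) y)
    (cdf (X (phi (psi k.+1)) t) y).
  rewrite [`|g _ - _|]distrC -/h in e2 *; lra.
rewrite lee_fin natrX (exprS 2 k).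
have -> : 2 * (8 * A + 2 * V) / (2 * 2 ^+ k) = (8 * A + 2 * V) * h.
  by rewrite /h; field; rewrite expf_neq0.
have -> : 2 * A * (2 * (2 * h ^+ 2) / h) + 2 * h * V = (8 * A + 2 * V) * h.
  by field; rewrite gt_eqF.
by [].
Qed.

(** As convergence is only asked on [K], the limit may be set to zero outside
    [K], which puts it in L^1 of the line. *)
Lemma relative_compactness (phi : nat -> nat) (T : R) (K : set R) :
  (forall n, (0 < phi n)%N) -> 0 <= T -> compact K ->
  exists2 psi : nat -> nat, increasing_seq psi &
  exists2 rho : R -> R -> R, in_CL1 T rho &
    supL1_dist T K (fun t => rhoN (phi (psi j)) t) rho @[j --> \oo] --> 0%E.
Proof.
move=> phi0 T0 cK; have mK : measurable K by exact: compact_measurable.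
have [A /ltW A0 KA] := compact_sub_segment cK.
have [psi psi_incr [C HC]] := geometric_subsequence T phi0 A0.
exists psi => //.
pose g (t : R) (k : nat) : R -> R := rhoN (phi (psi k)) t.
pose lim t (x : R) : R := fine (limn_esup (fun k => (g t k x)%:E)).
have mlim t : measurable_fun setT (lim t).
  by apply: measurable_fine_limn_esup => n; exact: mrho.
have limP (t : R) : 0 <= t <= T -> forall n,
    (\int[mu]_(x in K) `|g t n x - lim t x|%:E <= (C / 2 ^+ n)%:E)%E.
  move=> tT; apply: L1_geometric_limit => // n; first exact: mrho.
  apply: le_trans (HC n t tT); apply: L1_dist_subset => //; exact: mrho.
pose rho t x : R := \1_K x * lim t x.
have rhoE t x : K x -> rho t x = lim t x.
  by move=> Kx; rewrite /rho indicE mem_set// mul1r.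
have rho_out t x : ~ K x -> rho t x = 0.
  by move=> Kx; rewrite /rho indicE memNset// mul0r.
have mrho' t : measurable_fun setT (rho t).
  by apply: measurable_funM => //; exact: measurable_indic.
have rhoP (t : R) : 0 <= t <= T -> forall n,
    (\int[mu]_(x in K) `|g t n x - rho t x|%:E <= (C / 2 ^+ n)%:E)%E.
  move=> tT n; apply: le_trans (limP t tT n).
  rewrite le_eqVlt; apply/orP; left; apply/eqP.
  by apply: eq_integral => x /[!inE] Kx; rewrite rhoE.
have small (e : R) : 0 < e -> \forall n \near \oo, C / 2 ^+ n <= e.
  move=> e0; have : C / 2 ^+ n @[n --> \oo] --> (0 : R).
    have -> : (fun n => C / 2 ^+ n) = geometric C (2^-1 : R).
      by apply/funext => n; rewrite /geometric /= exprVn.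
    by apply: cvg_geometric; rewrite ger0_norm ?invr_ge0// invf_lt1// ltr1n.
  move=> /cvgrPdist_le/(_ e e0); apply: filterS => n.
  by rewrite sub0r normrN; apply: le_trans; exact: ler_norm.
exists rho.
  move=> t tT; split.
    apply/Lfun1_integrable; apply/integrableP; split.
      by apply/measurable_EFinP; exact: mrho'.
    have -> : (\int[mu]_x `|(EFin \o rho t) x| =
        \int[mu]_(x in K) `|rho t x - cst 0 x|%:E)%E.
      rewrite -L1_dist_support//; last exact: rho_out.
      by apply: eq_integral => x _; rewrite subr0.
    have := @L1_triangle _ K _ (g t 0%N) _ mK (mrho' t) (mrho _ t) _.
    move=> /(_ (cst 0) (measurable_cst _))/le_lt_trans; apply.
    rewrite lte_add_pinfty//.
      by rewrite L1_dist_sym (le_lt_trans (rhoP t tT 0%N))// ltry.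
    under eq_integral do rewrite subr0.
    have [KX _ _] := tX (phi0 (psi 0%N)); have /andP[t0 _] := tT.
    by have /integrableP[] := integrable_pc_dens mK (KX t t0).
  apply: cvge0_le => [s|e e0]; first exact: integral_ge0.
  have e4 : 0 < e / 4 by rewrite divr_gt0.
  have [n _ /(_ n (leqnn n)) /= Cn] := small _ e4.
  have [_] := tame_in_CL1 (tX (phi0 (psi n))) tT.
  move=> /fine_cvgP[fin /cvgrPdist_le/(_ _ e4)].
  apply: filter_app; apply: filter_app fin; rewrite /prop_near1 /within/=.
  apply: nearW => s sT fin.
  rewrite sub0r normrN ger0_norm ?fine_ge0 ?integral_ge0// => close.
  rewrite (L1_dist_support mK (rho_out s) (rho_out t)).
  have g1 := rhoP s sT n; have g2 := rhoP t tT n.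
  apply: (le_trans (L1_triangle mK (mrho' s) (mrho _ s) (mrho' t))).
  have -> : e%:E = ((e / 4)%:E + ((e / 4)%:E + (e / 2)%:E))%E.
    by rewrite -!EFinD; congr _%:E; field.
  apply: leeD.
    by rewrite (L1_dist_sym K (rho s)); apply: (le_trans g1); rewrite lee_fin.
  apply: (le_trans (L1_triangle mK (mrho _ s) (mrho _ t) (mrho' t))).
  apply: leeD; last by apply: (le_trans g2); rewrite lee_fin; lra.
  move: close; rewrite -lee_fin fineK//; apply: le_trans.
  by apply: L1_dist_subset => //; exact: mrho.
apply: cvge0_le => [n|e e0].
  apply: (@le_trans _ _ (\int[mu]_(x in K) `|g 0 n x - rho 0 x|%:E)%E).
    exact: integral_ge0.
  by apply: ereal_sup_ubound; exists 0 => //=; rewrite in_itv/= lexx.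
have := small e e0; apply: filterS => n Cn.
apply: ge_ereal_sup => _ [t tT <-].
apply: (le_trans (rhoP t tT n)); by rewrite lee_fin.
Qed.

End compactness.

(** * Properties of the limit densities *)

Section integrals_on_the_line.
Context {R : realType}.
Local Notation mu := (@lebesgue_measure R).

Lemma integral_segments_le (g : R -> \bar R) (c : \bar R) :
  measurable_fun setT g -> (forall x, (0 <= g x)%E) ->
  (forall A : R, 0 < A -> (\int[mu]_(x in `[(- A)%R, A]) g x <= c)%E) ->
  (\int[mu]_x g x <= c)%E.
Proof.
move=> mg g0 gc.
pose F (n : nat) : set R := `[(- n.+1%:R)%R, n.+1%:R%R]%classic.
have <- : \bigcup_n F n = setT.
  apply/seteqP; split => // x _; exists (Num.truncn `|x|) => //.
  by rewrite /F /= in_itv/= -ler_norml ltW// truncnS_gt.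
have ndF : nondecreasing_seq F.
  move=> n m nm; apply/subsetPset => x; rewrite /F /= !in_itv/= -!ler_norml => xn.
  by rewrite (le_trans xn)// ler_nat.
have cvgF : (\int[mu]_(x in F i) g x)%E @[i --> \oo] -->
    (\int[mu]_(x in \bigcup_i F i) g x)%E.
  apply: ge0_nondecreasing_set_cvg_integral => //.
    by move=> n; exact: measurable_itv.
  by move=> n; exact: measurable_funTS.
rewrite -(cvg_lim _ cvgF)//; apply: lime_le; first by apply/cvg_ex; eexists; exact: cvgF.
by apply: nearW => n; apply: gc.
Qed.

Lemma le_cvg_limit (c : \bar R) (u v : nat -> \bar R) (l : R) :
  (forall j, (c <= u j + v j)%E) -> u @ \oo --> l%:E -> v @ \oo --> 0%E ->
  (c <= l%:E)%E.
Proof.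
move=> cuv ul v0.
have uv : (u \+ v)%E @ \oo --> (l%:E + 0)%E by apply: cvgeD.
rewrite -[l%:E]adde0 -(cvg_lim _ uv)//; apply: lime_ge.
  by apply/cvg_ex; eexists; exact: uv.
exact: nearW.
Qed.

Lemma ae_imply (P Q : R -> Prop) : (forall x, P x -> Q x) ->
  {ae mu, forall x, P x} -> {ae mu, forall x, Q x}.
Proof. by move=> PQ; apply: (@filterS _ _ (ae_filter_ringOfSetsType _)). Qed.

Lemma measurable_max0 (f : R -> R) : measurable_fun setT f ->
  measurable_fun setT (fun x => Num.max 0 (f x)).
Proof. by move=> mf; apply: measurable_maxr. Qed.

Lemma ge0_max0 (f : R -> R) x : 0 <= Num.max 0 (f x).
Proof. by rewrite le_max lexx. Qed.

Lemma ae_integral_weight_max0 (f w : R -> R) : measurable_fun setT f ->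
  measurable_fun setT w -> {ae mu, forall x, 0 <= f x} ->
  (\int[mu]_x (w x * f x)%:E = \int[mu]_x (w x * Num.max 0 (f x))%:E)%E.
Proof.
move=> mf mw f0; apply: ae_eq_integral => //.
- by apply/measurable_EFinP; apply: measurable_funM.
- by apply/measurable_EFinP; apply: measurable_funM => //; exact: measurable_max0.
- by apply: ae_imply f0 => x fx _; rewrite max_r.
Qed.

Lemma ae_integral_max0 (f : R -> R) : measurable_fun setT f ->
  {ae mu, forall x, 0 <= f x} ->
  (\int[mu]_x (f x)%:E = \int[mu]_x (Num.max 0 (f x))%:E)%E.
Proof.
move=> mf f0; apply: ae_eq_integral => //.
- exact/measurable_EFinP.
- by apply/measurable_EFinP; exact: measurable_max0.
- by apply: ae_imply f0 => x fx _; rewrite max_r.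
Qed.

(** Moments are taken with weights [(|x| + c) `^ a], [c > 0], because they are
    continuous at 0 and because a displacement of mass by [d] amounts to
    replacing [c] by [c + d]. *)
Lemma continuous_shifted_powR (c a : R) : 0 < c ->
  continuous (fun x : R => (`|x| + c) `^ a).
Proof.
move=> c0 x.
have pos z : 0 < `|z| + c by rewrite ltr_wpDl.
have -> : (fun x : R => (`|x| + c) `^ a) =
    (fun x => expR (a * ln (`|x| + c))).
  by apply/funext => z; rewrite /powR gt_eqF.
apply: continuous_comp; last exact: continuous_expR.
apply: cvgM; first exact: cvg_cst.
apply: continuous_comp; last exact/continuous_ln.
by apply: cvgD; [exact: norm_continuous|exact: cvg_cst].
Qed.

Lemma shifted_powR_le (c a x : R) : 0 <= c -> 0 < a ->
  (`|x| + c) `^ a <= 2 `^ a * (`|x| `^ a + c `^ a).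
Proof.
move=> c0 a0; wlog : x c c0 / c <= `|x|.
  move=> H; have [/H//|/ltW xc] := leP c `|x|; first exact.
  have := H c `|x| (normr_ge0 x); rewrite (ger0_norm c0) => /(_ xc).
  by rewrite addrC [`|x| `^ a + _]addrC.
move=> cx; apply: (@le_trans _ _ ((2 * `|x|) `^ a)).
  apply: ge0_ler_powR; rewrite ?nnegrE ?addr_ge0 ?mulr_ge0 ?(ltW a0)//.
  by move: cx; lra.
by rewrite powRM// ler_wpM2l ?powR_ge0// lerDl powR_ge0.
Qed.

Lemma in_X_moment (rho0 : R -> R) : in_X rho0 ->
  exists2 a : R, 0 < a & forall c : R, 0 < c ->
  (\int[mu]_x ((`|x| + c) `^ a * Num.max 0 (rho0 x))%:E < +oo)%E.
Proof.
move=> [[rho1 _ _] [[a a0 [_ ma]] rho_ge0 mass]]; exists a => // c c0.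
have mrho0 : measurable_fun setT rho0.
  by have /Lfun1_integrable/measurable_int/measurable_EFinP := rho1.
have mabs : measurable_fun setT (fun x : R => `|x| `^ a).
  apply: (measurableT_comp (measurable_powR a)); exact: normr_measurable.
have mw : measurable_fun setT (fun x : R => (`|x| + c) `^ a).
  by apply: continuous_measurable_fun; exact: continuous_shifted_powR.
have mp := measurable_max0 mrho0.
apply: (@le_lt_trans _ _ (\int[mu]_x
    ((2 `^ a)%:E * (`|x| `^ a * Num.max 0 (rho0 x))%:E +
     (2 `^ a * c `^ a)%:E * (Num.max 0 (rho0 x))%:E))%E).
  apply: ge0_le_integral => //.
  - by move=> x _; rewrite lee_fin mulr_ge0 ?powR_ge0 ?ge0_max0.
  - by apply/measurable_EFinP; exact: measurable_funM.
  - apply: emeasurable_funD; apply: measurable_funeM; apply/measurable_EFinP => //.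
    exact: measurable_funM.
  - move=> x _; rewrite -!EFinM -EFinD lee_fin !mulrA -mulrDl.
    rewrite ler_wpM2r ?ge0_max0// -mulrDr; apply: shifted_powR_le => //.
    exact: ltW.
rewrite ge0_integralD//=.
- rewrite !ge0_integralZl_EFin//.
  + rewrite lte_add_pinfty// lte_mul_pinfty// ?lee_fin ?mulr_ge0 ?powR_ge0//.
      by rewrite -ae_integral_weight_max0.
    by rewrite -ae_integral_max0// mass ltry.
  + by move=> x _; rewrite lee_fin ge0_max0.
  + exact/measurable_EFinP.
  + by rewrite mulr_ge0 ?powR_ge0.
  + by move=> x _; rewrite lee_fin mulr_ge0 ?powR_ge0 ?ge0_max0.
  + by apply/measurable_EFinP; exact: measurable_funM.
- by move=> x _; rewrite -EFinM lee_fin !mulr_ge0 ?powR_ge0 ?ge0_max0.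
- by apply: measurable_funeM; apply/measurable_EFinP; exact: measurable_funM.
- by move=> x _; rewrite -EFinM lee_fin !mulr_ge0 ?powR_ge0 ?ge0_max0.
- by apply: measurable_funeM; apply/measurable_EFinP.
Qed.

End integrals_on_the_line.

Section limit_density.
Context {R : realType}.
Local Notation mu := (@lebesgue_measure R).

(** [x_ j] and [y_ j] stand for the configurations at a given time and at time
    0; [r] is the local L^1 limit of the former and [rho0] the narrow limit of
    the latter. *)
Context (V d : R) (rho0 r : R -> R) (n_ : nat -> nat)
  (x_ y_ : forall j, 'rV[R]_(n_ j).+1).
Hypotheses (n0 : forall j, (0 < n_ j)%N) (Kx : forall j, in_K (x_ j))
  (Ky : forall j, in_K (y_ j)) (xV : forall j, sum_jumps (x_ j) <= V)
  (d0 : 0 <= d)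
  (xy : forall j i, (i <= n_ j)%N -> `|pos (x_ j) i - pos (y_ j) i| <= d)
  (rho0X : in_X rho0) (mr : measurable_fun setT r).
Hypothesis r_lim : forall A : R, 0 < A ->
  (\int[mu]_(z in `[(- A)%R, A]) `|pc_dens (x_ j) z - r z|%:E)%E
    @[j --> \oo] --> 0%E.
Hypothesis y_lim : forall phi : R -> R, continuous phi ->
  (exists M : R, forall z, `|phi z| <= M) ->
  (\int[mu]_z (phi z * pc_dens (y_ j) z)%:E)%E @[j --> \oo] -->
  (\int[mu]_z (phi z * rho0 z)%:E)%E.

Let mpc (j : nat) : measurable_fun setT (pc_dens (x_ j)).
Proof. exact: measurable_pc_dens. Qed.

Let r1 (z : R) : R := Num.max 0 (r z).

Let mr1 : measurable_fun setT r1. Proof. exact: measurable_max0. Qed.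

Let r1_ge0 z : 0 <= r1 z. Proof. exact: ge0_max0. Qed.

Let r1_le j z : r1 z <= pc_dens (x_ j) z + `|pc_dens (x_ j) z - r z|.
Proof.
rewrite /r1; have := pc_dens_ge0 z (@Kx j).
have := ler_norm (r z - pc_dens (x_ j) z); rewrite distrC.
have := normr_ge0 (pc_dens (x_ j) z - r z).
by case: (lerP 0 (r z)) => *; lra.
Qed.

(** The distances on the right-hand side tend to 0 in L^1 on every segment. *)
Let ae_eq0_dominated (q : R -> R) : measurable_fun setT q ->
  (forall z, 0 <= q z) -> (forall j z, q z <= `|pc_dens (x_ j) z - r z|) ->
  {ae mu, forall z, q z = 0}.
Proof.
move=> mq q0 qle.
have mqE : measurable_fun setT (EFin \o q) by exact/measurable_EFinP.
have q_int : (\int[mu]_z `|(q z)%:E| = 0)%E.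
  under eq_integral do rewrite gee0_abs ?lee_fin//.
  apply/eqP; rewrite eq_le; apply/andP; split; last first.
    by apply: integral_ge0 => z _; rewrite lee_fin.
  apply: integral_segments_le => //= A A0.
  apply: (@le_cvg_limit _ _ (cst 0%E) _ _ _ _ (r_lim A0)) => [j|]; last first.
    exact: cvg_cst.
  rewrite add0e; apply: ge0_le_integral => //.
  - by move=> z _; rewrite lee_fin.
  - exact: measurable_funTS.
  - exact: measurable_dist.
  - by move=> z _; rewrite lee_fin.
have [+ _] := ae_eq_integral_abs mu measurableT mqE.
move=> /(_ q_int); apply: ae_imply => z /(_ I) /= qz.
by have [] := qz.
Qed.

Lemma limit_density_ge0 : {ae mu, forall z, 0 <= r z}.
Proof.
apply: (@ae_imply _ (fun z => Num.max 0 (- r z) = 0)).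
  by move=> z; case: (lerP 0 (- r z)) => h e; lra.
apply: ae_eq0_dominated => [|z|j z].
- by apply: measurable_max0; exact: measurable_funN.
- exact: ge0_max0.
have := pc_dens_ge0 z (@Kx j); have := ler_norm (pc_dens (x_ j) z - r z).
have := normr_ge0 (pc_dens (x_ j) z - r z).
by case: (lerP 0 (- r z)) => *; lra.
Qed.

Lemma limit_density_leV : {ae mu, forall z, r z <= V}.
Proof.
apply: (@ae_imply _ (fun z => Num.max 0 (r z - V) = 0)).
  by move=> z; case: (lerP 0 (r z - V)) => h e; lra.
apply: ae_eq0_dominated => [|z|j z].
- by apply: measurable_max0; apply: measurable_funB => //; exact: measurable_cst.
- exact: (ge0_max0 (fun z => r z - V)).
have := le_trans (pc_dens_le_sum_jumps z (@Kx j)) (xV j).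
have := ler_norm (r z - pc_dens (x_ j) z); rewrite distrC.
have := normr_ge0 (pc_dens (x_ j) z - r z).
by case: (lerP 0 (r z - V)) => *; lra.
Qed.

Lemma limit_density_Linfty : r \in Lfun mu +oo%E.
Proof.
rewrite inE /=; apply/andP; split; rewrite inE//=.
rewrite /finite_norm unlock /=; case: ifPn => // _.
apply: (@le_lt_trans _ _ V%:E); last exact: ltry.
apply/ess_supP.
have := @filterI _ _ (ae_filter_ringOfSetsType mu) _ _
  limit_density_ge0 limit_density_leV.
by apply: ae_imply => z [/= z0 zV]; rewrite lee_fin ger0_norm.
Qed.

(** Upper bounds for integrals of the approximating densities pass to the limit
    density, first on a segment, where the convergence is strong. *)
Let segment_le (A B : R) (g : R -> R) (u : nat -> \bar R) (l : R) : 0 < A ->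
  continuous g -> (forall z, 0 <= g z <= B) ->
  (forall j, (\int[mu]_z (pc_dens (x_ j) z * g z)%:E <= u j)%E) ->
  u @ \oo --> l%:E ->
  (\int[mu]_(z in `[(- A)%R, A]) (r1 z * g z)%:E <= l%:E)%E.
Proof.
move=> A0 cg gB gu ul.
have mg : measurable_fun setT g by exact: continuous_measurable_fun.
have B0 : 0 <= B by have /andP[h1 h2] := gB 0; exact: le_trans h2.
have g0 z : 0 <= g z by have /andP[] := gB z.
have mpg j (D : set R) : measurable_fun D (fun z => (pc_dens (x_ j) z * g z)%:E).
  by apply/measurable_EFinP; apply: measurable_funTS; exact: measurable_funM.
have vlim : (B%:E * \int[mu]_(z in `[(- A)%R, A]) `|pc_dens (x_ j) z - r z|%:E)%E
    @[j --> \oo] --> 0%E.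
  by rewrite -[X in _ --> X](mule0 B%:E); apply: cvgeZl => //; exact: r_lim.
apply: le_cvg_limit ul vlim => j.
apply: (@le_trans _ _ (\int[mu]_(z in `[(- A)%R, A]) (pc_dens (x_ j) z * g z)%:E +
  B%:E * \int[mu]_(z in `[(- A)%R, A]) `|pc_dens (x_ j) z - r z|%:E)%E); last first.
  rewrite leeD2r//; apply: le_trans (gu j); apply: ge0_subset_integral => //.
  - exact: mpg.
  - by move=> z _; rewrite lee_fin mulr_ge0// pc_dens_ge0.
rewrite -ge0_integralZl_EFin//; last exact: measurable_dist.
rewrite -ge0_integralD//; last 4 first.
- by move=> z _; rewrite lee_fin mulr_ge0// pc_dens_ge0.
- exact: mpg.
- by move=> z _; rewrite mule_ge0 ?lee_fin.
- by apply: measurable_funeM; exact: measurable_dist.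
apply: ge0_le_integral => //.
- by move=> z _; rewrite lee_fin mulr_ge0.
- by apply/measurable_EFinP; apply: measurable_funTS; exact: measurable_funM.
- apply: emeasurable_funD; first exact: mpg.
  by apply: measurable_funeM; exact: measurable_dist.
move=> z _; rewrite -EFinM -EFinD lee_fin.
have /andP[gz0 gzB] := gB z.
apply: (@le_trans _ _ ((pc_dens (x_ j) z + `|pc_dens (x_ j) z - r z|) * g z)).
  by rewrite ler_wpM2r.
by rewrite mulrDl lerD2l mulrC ler_wpM2r.
Qed.

Let r1_mass_le1 : (\int[mu]_z (r1 z)%:E <= 1)%E.
Proof.
apply: integral_segments_le.
- exact/measurable_EFinP.
- by move=> z; rewrite lee_fin.
move=> A A0.
have := @segment_le A 1 (cst 1) (cst 1%E) 1 A0 (@cst_continuous _ _ _).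
under eq_integral do rewrite /cst mulr1; apply.
- by move=> z; rewrite ler01 lexx.
- move=> j; under eq_integral do rewrite mulr1.
  by rewrite integral_pc_dens1.
- exact: cvg_cst.
Qed.

Let r_integrable : mu.-integrable setT (EFin \o r).
Proof.
apply/integrableP; split; first exact/measurable_EFinP.
apply: (@le_lt_trans _ _ (\int[mu]_z (r1 z)%:E)%E); last first.
  by rewrite (le_lt_trans r1_mass_le1)// ltry.
rewrite le_eqVlt; apply/orP; left; apply/eqP.
apply: ae_eq_integral => //.
- by apply: measurableT_comp => //; exact/measurable_EFinP.
- exact/measurable_EFinP.
by apply: ae_imply limit_density_ge0 => z z0 _; rewrite /= /r1 max_r// ger0_norm.
Qed.

Lemma limit_density_L1 : r \in Lfun mu 1%E.
Proof. exact/Lfun1_integrable. Qed.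

Let w (c a : R) (z : R) : R := (`|z| + c) `^ a.

Let w_ge0 c a z : 0 <= w c a z. Proof. exact: powR_ge0. Qed.

Let mw c a : 0 < c -> measurable_fun setT (w c a).
Proof.
by move=> c0; apply: continuous_measurable_fun; exact: continuous_shifted_powR.
Qed.

Let tw (c a M : R) (z : R) : R := Num.min (w c a z) M.

Let continuous_tw (c a M : R) : 0 < c -> continuous (tw c a M).
Proof.
move=> c0; have cw := @continuous_shifted_powR R c a c0.
have -> : tw c a M = fun z => (w c a z + M - `|w c a z - M|) / 2.
  by apply/funext => z; rewrite /tw minr_absE.
move=> z; apply: cvgM; last exact: cvg_cst.
apply: cvgB; first by apply: cvgD; [exact: cw|exact: cvg_cst].
by apply: cvg_norm; apply: cvgB; [exact: cw|exact: cvg_cst].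
Qed.

Let tw_bounds c a M z : 0 <= M -> 0 <= tw c a M z <= M.
Proof. by move=> M0; rewrite /tw le_min w_ge0 M0 ge_min lexx orbT. Qed.

(** Mass moves by at most [d], so moments at the current time are bounded by
    moments at time 0. The truncation makes the weights bounded, as the narrow
    convergence at time 0 requires. *)
Let truncated_le (a M : R) : 0 < a -> forall j,
  (\int[mu]_z (pc_dens (x_ j) z * tw 1 a M z)%:E <=
   \int[mu]_z (tw (1 + d) a M z * pc_dens (y_ j) z)%:E)%E.
Proof.
move=> a0 j; apply: (@le_trans _ _
  (\int[mu]_z (pc_dens (y_ j) z * tw (1 + d) a M z)%:E)%E); last first.
  by under eq_integral do rewrite mulrC.
apply: (pc_dens_transport (@Kx j) (@Ky j) _ _ (xy (j := j))).
- exact: continuous_tw.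
- by apply: continuous_tw; rewrite ltr_wpDr.
move=> z z' zz'; rewrite /tw le_min !ge_min lexx orbT andbT.
rewrite /w ge0_ler_powR ?nnegrE ?addr_ge0 ?(ltW a0)//.
have := ler_normD (z - z') z'; rewrite subrK; lra.
Qed.

Let C (a : R) : \bar R := (\int[mu]_z (w (1 + d) a z * Num.max 0 (rho0 z))%:E)%E.

Let mrho0 : measurable_fun setT rho0.
Proof.
by case: rho0X => [[/Lfun1_integrable/measurable_int/measurable_EFinP]].
Qed.

Let truncated_lim (a M : R) : 0 <= M -> (C a < +oo)%E ->
  exists2 l : R, (l%:E <= C a)%E &
    (\int[mu]_z (tw (1 + d) a M z * pc_dens (y_ j) z)%:E)%E @[j --> \oo]
      --> l%:E.
Proof.
move=> M0 Cfin.
have d1 : 0 < 1 + d by rewrite ltr_wpDr.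
have ctw := @continuous_tw (1 + d) a M d1.
have mtw : measurable_fun setT (tw (1 + d) a M) by exact: continuous_measurable_fun.
have mm := measurable_max0 mrho0.
have leC : (\int[mu]_z (tw (1 + d) a M z * rho0 z)%:E <= C a)%E.
  rewrite ae_integral_weight_max0//; last by case: rho0X => _ [].
  apply: ge0_le_integral => //.
  - move=> z _; rewrite lee_fin mulr_ge0 ?ge0_max0//.
    by have /andP[] := tw_bounds (1 + d) a z M0.
  - by apply/measurable_EFinP; exact: measurable_funM.
  - by apply/measurable_EFinP; apply: measurable_funM => //; exact: mw.
  - by move=> z _; rewrite lee_fin ler_wpM2r ?ge0_max0// /tw ge_min lexx.
have fin : (\int[mu]_z (tw (1 + d) a M z * rho0 z)%:E)%E \is a fin_num.
  rewrite ge0_fin_numE ?(le_lt_trans leC)//.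
  rewrite ae_integral_weight_max0//; last by case: rho0X => _ [].
  apply: integral_ge0 => z _; rewrite lee_fin mulr_ge0 ?ge0_max0//.
  by have /andP[] := tw_bounds (1 + d) a z M0.
exists (fine (\int[mu]_z (tw (1 + d) a M z * rho0 z)%:E)%E); first by rewrite fineK.
rewrite fineK//; apply: y_lim => //; exists M => z.
by have /andP[h1 h2] := tw_bounds (1 + d) a z M0; rewrite ger0_norm.
Qed.

Let moment_le (a : R) : 0 < a -> (C a < +oo)%E ->
  (\int[mu]_z (`|z| `^ a * r1 z)%:E <= C a)%E.
Proof.
move=> a0 Cfin.
have mabs : measurable_fun setT (fun z : R => `|z| `^ a).
  by apply: (measurableT_comp (measurable_powR a)); exact: normr_measurable.
have mint : measurable_fun setT (fun z : R => (`|z| `^ a * r1 z)%:E).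
  by apply/measurable_EFinP; exact: measurable_funM.
apply: integral_segments_le => // [z|A A0].
  by rewrite lee_fin mulr_ge0 ?powR_ge0.
pose M := (A + 1) `^ a; have M0 : 0 <= M by exact: powR_ge0.
have [l lC ul] := truncated_lim M0 Cfin.
apply: le_trans lC.
apply: le_trans (segment_le A0 (@continuous_tw 1 a M ltr01)
  (fun z => tw_bounds 1 a z M0) (@truncated_le a M a0) ul).
apply: ge0_le_integral => //.
- by move=> z _; rewrite lee_fin mulr_ge0 ?powR_ge0.
- exact: measurable_funTS.
- apply/measurable_EFinP; apply: measurable_funTS; apply: measurable_funM => //.
  by apply: continuous_measurable_fun; exact: continuous_tw.
move=> z /=; rewrite in_itv/= -ler_norml => zA.
rewrite lee_fin mulrC ler_wpM2l// /tw le_min.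
by apply/andP; split; apply: ge0_ler_powR;
  rewrite ?nnegrE ?addr_ge0 ?(ltW a0) ?(ltW A0) ?lerDl// (le_trans zA)// lerDl.
Qed.

(** Outside [-A, A] the truncated weight is at least [(A + 1) ^ a], so the mass
    escaping from [-A, A] vanishes as [A] grows. *)
Let mass_ge (a A : R) : 0 < a -> (C a < +oo)%E -> 0 < A ->
  (1 <= \int[mu]_z (r1 z)%:E + (((A + 1) `^ a)^-1)%:E * C a)%E.
Proof.
move=> a0 Cfin A0; set M := (A + 1) `^ a.
have M0 : 0 < M by rewrite powR_gt0// addr_gt0.
have [l lC ul] := truncated_lim (ltW M0) Cfin.
have ctw := @continuous_tw 1 a M ltr01.
have mtw : measurable_fun setT (tw 1 a M) by exact: continuous_measurable_fun.
have r1fin : (\int[mu]_z (r1 z)%:E)%E \is a fin_num.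
  rewrite ge0_fin_numE ?(le_lt_trans r1_mass_le1) ?ltry//.
  by apply: integral_ge0 => z _; rewrite lee_fin.
suff : (1 <= (fine (\int[mu]_z (r1 z)%:E) + M^-1 * l)%:E)%E.
  move/le_trans; apply; rewrite EFinD fineK// EFinM leeD2l//.
  by rewrite lee_wpmul2l// lee_fin invr_ge0 ltW.
apply: (@le_cvg_limit _ _ (fun j => \int[mu]_z (r1 z)%:E + (M^-1)%:E *
    \int[mu]_z (tw (1 + d) a M z * pc_dens (y_ j) z)%:E)%E _ _ _ _ (r_lim A0))
  => [j|]; last first.
  rewrite EFinD fineK// EFinM; apply: cvgeD.
  - by rewrite fin_num_adde_defr.
  - exact: cvg_cst.
  - exact: cvgeZl.
pose D : set R := `[(- A), A]%classic.
pose dist z := (`|pc_dens (x_ j) z - r z|%:E : \bar R).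
have mdist : measurable_fun setT (dist \_ D).
  have md : measurable_fun D dist by apply: measurable_dist; [exact: mpc|exact: mr].
  apply/(measurable_restrictT _ _).1; last exact: md.
  exact: measurable_itv.
have dist0 z : (0 <= (dist \_ D) z)%E.
  by rewrite patchE; case: ifPn => // _; rewrite lee_fin.
have mpt : measurable_fun setT (fun z => (pc_dens (x_ j) z * tw 1 a M z)%:E).
  by apply/measurable_EFinP; exact: measurable_funM.
have tw0 z : 0 <= tw 1 a M z by have /andP[] := tw_bounds 1 a z (ltW M0).
have Mi0 : 0 <= M^-1 by rewrite invr_ge0 ltW.
apply: (@le_trans _ _ (\int[mu]_z (r1 z)%:E +
  (M^-1)%:E * \int[mu]_z (pc_dens (x_ j) z * tw 1 a M z)%:E +
  \int[mu]_z (dist \_ D) z)%E); last first.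
  rewrite -integral_mkcond leeD2r// leeD2l// lee_wpmul2l ?lee_fin//.
  exact: truncated_le.
rewrite -(integral_pc_dens1 (@Kx j) (n0 j)).
rewrite -ge0_integralZl_EFin//; last first.
  by move=> z _; rewrite lee_fin mulr_ge0// pc_dens_ge0.
have Mpt0 z : (0 <= (M^-1)%:E * (pc_dens (x_ j) z * tw 1 a M z)%:E)%E.
  by rewrite -EFinM lee_fin !mulr_ge0// pc_dens_ge0.
rewrite -ge0_integralD//; last 3 first.
- by move=> z _; rewrite lee_fin.
- exact/measurable_EFinP.
- exact: measurable_funeM.
rewrite -ge0_integralD//; last 2 first.
- by move=> z _; rewrite adde_ge0// lee_fin.
- by apply: emeasurable_funD; [exact/measurable_EFinP|exact: measurable_funeM].
apply: ge0_le_integral => //.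
- by move=> z _; rewrite lee_fin pc_dens_ge0.
- by apply/measurable_EFinP; exact: mpc.
- apply: emeasurable_funD => //.
  by apply: emeasurable_funD; [exact/measurable_EFinP|exact: measurable_funeM].
move=> z _; have pz := pc_dens_ge0 z (@Kx j).
rewrite patchE; case: ifPn => zA.
  rewrite -EFinM -!EFinD lee_fin.
  have h1 : 0 <= M^-1 * (pc_dens (x_ j) z * tw 1 a M z) by rewrite !mulr_ge0.
  have := ler_norm (pc_dens (x_ j) z - r z); move: h1; rewrite /r1.
  by case: (lerP 0 (r z)) => *; lra.
rewrite adde0 -EFinM -EFinD lee_fin.
have -> : tw 1 a M z = M.
  rewrite /tw min_r// /M /w; apply: ge0_ler_powR;
    rewrite ?nnegrE ?addr_ge0 ?(ltW a0) ?(ltW A0)//.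
  rewrite lerD2r; move: zA; rewrite notin_setE /D /= in_itv/= -ler_norml.
  by move=> /negP; rewrite -ltNge => /ltW.
by rewrite mulrCA mulVf ?gt_eqF// mulr1 lerDr.
Qed.

Lemma limit_density_mass : (\int[mu]_z (r z)%:E = 1)%E.
Proof.
rewrite ae_integral_max0//; last exact: limit_density_ge0.
apply/eqP; rewrite eq_le r1_mass_le1/=; apply/lee_addgt0Pr => e e0.
have [a a0 /(_ (1 + d))] := in_X_moment rho0X.
rewrite ltr_wpDr// => /(_ isT) Cfin.
have C0 : (0 <= C a)%E.
  by apply: integral_ge0 => z _; rewrite lee_fin mulr_ge0 ?ge0_max0.
pose c := fine (C a).
have cE : C a = c%:E by rewrite /c fineK// ge0_fin_numE.
have c0 : 0 <= c by rewrite -lee_fin -cE.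
pose A := (1 + c / e) `^ a^-1.
have ce : 0 < 1 + c / e by rewrite ltr_wpDr// divr_ge0// ltW.
have A0 : 0 < A by rewrite powR_gt0.
apply: (le_trans (mass_ge a0 Cfin A0)); rewrite leeD2l// cE -EFinM lee_fin.
have h : 1 + c / e <= (A + 1) `^ a.
  have -> : 1 + c / e = A `^ a.
    by rewrite /A -powRrM mulVf ?gt_eqF// powRr1// ltW.
  by apply: ge0_ler_powR; rewrite ?nnegrE ?addr_ge0 ?(ltW a0) ?(ltW A0)// lerDl.
rewrite ler_pdivrMl ?(lt_le_trans ce)// -ler_pdivrMr//.
by apply: le_trans h; rewrite lerDr.
Qed.

Lemma limit_density_moment : exists2 a : R, 0 < a & in_M a r.
Proof.
have [a a0 /(_ (1 + d))] := in_X_moment rho0X.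
rewrite ltr_wpDr// => /(_ isT) Cfin; exists a => //; split.
  exact: limit_density_L1.
rewrite ae_integral_weight_max0//; last exact: limit_density_ge0.
  exact: le_lt_trans (moment_le a0 Cfin) Cfin.
by apply: (measurableT_comp (measurable_powR a)); exact: normr_measurable.
Qed.

(** The total variation is lower semicontinuous for local L^1 convergence. *)
Lemma limit_density_tot_var : (tot_var r <= V%:E)%E.
Proof.
apply: ge_ereal_sup => _ [phi phit <-]; have [dphi cphi cpt _] := phit.
have [A A0 suppA] := compact_sub_segment cpt.
have dphi_out z : ~ `[- A, A]%classic z -> derive1 phi z = 0.
  move=> zA; rewrite derive1E (@near_eq_derive _ _ _ phi (cst 0)) ?derive_cst//.
  have : nbhs z (~` closure [set y | phi y != 0]).
    apply: open_nbhs_nbhs; split; last by move=> /suppA.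
    by apply: closed_openC; exact: closed_closure.
  apply: filterS => y yphi; apply: contrapT => /eqP phiy; apply: yphi.
  exact: subset_closure.
have [B0 [_ HB]] : bounded_set (derive1 phi @` `[- A, A]).
  apply: compact_bounded; apply: continuous_compact; last exact: segment_compact.
  exact: continuous_subspaceT.
pose B := `|B0| + 1; have B_ge0 : 0 <= B by rewrite addr_ge0.
have dphiB z : `|derive1 phi z| <= B.
  have [zA|/dphi_out->] := pselect (`[- A, A]%classic z); last by rewrite normr0.
  by apply: HB; [rewrite (le_lt_trans (ler_norm _))// ltrDl|exists z].
have mphi : measurable_fun setT (derive1 phi) by exact: continuous_measurable_fun.
apply: (@le_cvg_limit _ _ (cst V%:E) (fun j => B%:E *
    \int[mu]_(z in `[(- A)%R, A]) `|pc_dens (x_ j) z - r z|%:E)%E) => [j||]; last 2 first.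
- exact: cvg_cst.
- by rewrite -[X in _ --> X](mule0 B%:E); apply: cvgeZl => //; exact: r_lim.
pose D : set R := `[(- A), A]%classic.
have mD : measurable D by exact: measurable_itv.
pose dist z := (`|pc_dens (x_ j) z - r z|%:E : \bar R).
have weighted (f : R -> R) : mu.-integrable setT (EFin \o f) ->
    mu.-integrable setT (fun z => (f z * derive1 phi z)%:E).
  move=> intf; have := integrableZl measurableT B (integrable_abse intf).
  have /measurable_int/measurable_EFinP mf := intf.
  apply: le_integrable => //.
    by apply/measurable_EFinP; exact: measurable_funM.
  move=> z _ /=; rewrite lee_fin !normrM normr_id (ger0_norm B_ge0).
  by rewrite mulrC ler_wpM2r.
have intpc : mu.-integrable setT (EFin \o pc_dens (x_ j)).
  by apply: integrable_pc_dens => //; exact: Kx.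
have intdist : mu.-integrable setT (dist \_ D).
  apply/(integrable_mkcond _ _).1; first exact: mD.
  apply: (@integrableS _ _ _ mu setT) => //.
  exact: integrable_abse (integrableB measurableT intpc r_integrable).
rewrite [X in (_ * X)%E]integral_mkcond -ge0_integralZl_EFin//; last 2 first.
- by move=> z _; rewrite patchE; case: ifPn => // _; rewrite lee_fin.
- exact: measurable_int intdist.
apply: (@le_trans _ _ (\int[mu]_z ((pc_dens (x_ j) z * derive1 phi z)%:E +
    B%:E * (dist \_ D) z))%E).
  apply: le_integral => //; first exact: weighted.
    by apply: integrableD => //; [exact: weighted|exact: integrableZl].
  move=> z _; rewrite patchE; case: ifPn => zA.
    rewrite -EFinM -EFinD lee_fin -lerBlDl -mulrBl.
    rewrite (le_trans (ler_norm _))// normrM distrC mulrC.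
    by rewrite ler_wpM2r.
  by move: zA; rewrite notin_setE => /dphi_out ->; rewrite !mulr0 mule0 adde0.
rewrite integralD//; [|exact: weighted|exact: integrableZl].
rewrite leeD2r//; apply: (@le_trans _ _ (tot_var (pc_dens (x_ j)))).
  by apply: ereal_sup_ubound; exists phi.
apply: (le_trans (tot_var_pc_dens_le (@Kx j))).
by rewrite lee_fin xV.
Qed.

Lemma limit_density_in_X : in_X r.
Proof.
split; split.
- exact: limit_density_L1.
- exact: limit_density_Linfty.
- split; first exact: limit_density_L1.
  exact: le_lt_trans limit_density_tot_var (ltry _).
- exact: limit_density_moment.
- exact: limit_density_ge0.
- exact: limit_density_mass.
Qed.

End limit_density.

(** * Limits of the Follow-the-Leader densities *)

Lemma increasing_seq_ge (phi : nat -> nat) : increasing_seq phi ->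
  forall n, (n <= phi n)%N.
Proof.
move=> /increasing_seqP incr; elim=> // n IH.
by apply: leq_ltn_trans IH _; have := incr n; rewrite ltEnat.
Qed.

(** The variation [V] of [rho0] bounds the variation of all densities at all
    times, hence the densities themselves; then a bound [L] for [v] on [0, V]
    bounds all velocities. *)
Lemma FtL_tame {R : realType} (v : R -> R)
    (S : forall N : nat, (R -> R) -> 'rV[R]_N.+1) (rho0 : R -> R)
    (X : forall N : nat, R -> 'rV[R]_N.+1) :
  bounded_on_segments v -> admissible_sampling S -> in_X rho0 ->
  (forall N : nat, (0 < N)%N -> FtL_solution v (S N rho0) (X N)) ->
  exists V, exists2 L, 0 <= L & forall N, (0 < N)%N -> tame_flow V L (X N).
Proof.
move=> vb hS hrho0 hX; have [K0 _ _ tv] := hS _ hrho0.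
have [_ fin] : BV rho0 by case: hrho0 => [[]].
have V0 N : (0 < N)%N -> ((sum_jumps (S N rho0))%:E <= tot_var rho0)%E.
  move=> N0; apply: le_trans (tv N N0).
  by apply: sum_jumps_le_tot_var => //; exact: K0.
have tv0 : (0 <= tot_var rho0)%E.
  by apply: le_trans (V0 1%N isT); rewrite lee_fin sum_jumps_ge0.
exists (fine (tot_var rho0)).
have [L vL] := vb (fine (tot_var rho0)).
have L0 : 0 <= L.
  apply: (@le_trans _ _ `|v 0|) => //; apply: vL.
  by rewrite lexx fine_ge0.
exists L => // N N0.
have SV : sum_jumps (S N rho0) <= fine (tot_var rho0).
  by rewrite -lee_fin fineK ?V0// ge0_fin_numE.
split.
- by case: (hX N N0) => _ + _ _; apply.
- move=> t t0; apply: le_trans SV.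
  exact: (sum_jumps_nonincreasing vb N0 (hX N N0)).
- move=> i s t iN s0 t0; exact: (pos_lipschitz vb N0 (hX N N0) vL SV).
Qed.

Theorem theorem4p1 (R : realType) (v : R -> R)
    (hv : [locally [lipschitz v x | x in `[0, +oo[]])
    (S : forall N : nat, (R -> R) -> 'rV[R]_N.+1)
    (hS : admissible_sampling S)
    (rho0 : R -> R) (hrho0 : in_X rho0)
    (X : forall N : nat, R -> 'rV[R]_N.+1)
    (hX : forall N : nat, (0 < N)%N -> FtL_solution v (S N rho0) (X N)) :
  let rhoN : nat -> R -> R -> R := fun N t => pc_dens (X N t) in
  (forall (T : R) (K : set R), 0 <= T -> compact K ->
     (forall N : nat, (0 < N)%N -> in_CL1 T (rhoN N)) /\
     (forall phi : nat -> nat, increasing_seq phi -> (0 < phi 0)%N ->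
        exists2 psi : nat -> nat, increasing_seq psi &
        exists2 rho : R -> R -> R, in_CL1 T rho &
          supL1_dist T K (rhoN (phi (psi j))) rho @[j --> \oo] --> 0%E))
  /\
  (forall rho : R -> R -> R,
     measurable_fun [set p : R * R | 0 <= p.1] (fun p : R * R => rho p.1 p.2) ->
     (exists phi : nat -> nat, [/\ increasing_seq phi, (0 < phi 0)%N &
        forall (T : R) (K : set R), 0 <= T -> compact K ->
          supL1_dist T K (rhoN (phi j)) rho @[j --> \oo] --> 0%E]) ->
     {ae (@lebesgue_measure R \x @lebesgue_measure R)%E,
        forall p : R * R, 0 <= p.1 -> 0 <= rho p.1 p.2} /\
     (forall t : R, 0 <= t -> in_X (rho t))).
Proof.
move=> rhoN.
have vb := locally_lipschitz_bounded hv.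
have [V [L L0 tX]] := FtL_tame vb hS hrho0 hX.
split.
  move=> T K T0 cK; split; first by move=> N N0; exact: (@tame_in_CL1 R V L N (X N) (tX N N0) T).
  move=> phi incr phi0.
  have phi_gt0 n : (0 < phi n)%N by rewrite (leq_trans phi0)// incr.
  exact: (@relative_compactness R V L X tX phi T K phi_gt0 T0 cK).
move=> rho mrho [phi [incr phi0 cvg]].
have phi_gt0 n : (0 < phi n)%N by rewrite (leq_trans phi0)// incr.
have mD : measurable [set p : R * R | 0 <= p.1].
  rewrite (_ : [set p : R * R | 0 <= p.1] = setT `&` fst @^-1` `[0, +oo[%classic).
    by apply: measurable_fst => //; exact: measurable_itv.
  by apply/seteqP; split => p /=; rewrite in_itv/= andbT; [|case].
have mrho_t (t : R) : 0 <= t -> measurable_fun setT (rho t).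
  move=> t0; apply: (measurable_comp mD _ mrho (g := pair t)) => //.
  by move=> _ [x _ <-].
have r_lim : forall t : R, 0 <= t -> forall A : R, 0 < A ->
    (\int[@lebesgue_measure R]_(z in `[(- A)%R, A])
       `|pc_dens (X (phi j) t) z - rho t z|%:E)%E @[j --> \oo] --> 0%E.
  move=> t t0 A A0.
  have cA : compact (`[- A, A]%classic : set R) by exact: segment_compact.
  apply: (squeeze_cvge _ (cvg_cst 0%E) (cvg t _ t0 cA)).
  apply: nearW => j; rewrite integral_ge0//=.
  by apply: ereal_sup_ubound; exists t => //=; rewrite in_itv/= t0 lexx.
have rhoX : forall t : R, 0 <= t -> in_X (rho t).
  move=> t t0; have [K0 narrow _ _] := hS _ hrho0.
  apply: (@limit_density_in_X R V (L * t) rho0 (rho t) phi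
    (fun j => X (phi j) t) (fun j => S (phi j) rho0)) => //.
  - by move=> j; have [KX _ _] := tX _ (phi_gt0 j); exact: KX.
  - by move=> j; exact: K0.
  - by move=> j; have [_ XV _] := tX _ (phi_gt0 j); exact: XV.
  - by rewrite mulr_ge0.
  - move=> j i iN; have [_ _ XL] := tX _ (phi_gt0 j).
    have [X0 _ _ _] := hX _ (phi_gt0 j).
    by have := XL i 0 t iN (lexx _) t0; rewrite subr0 (ger0_norm t0) X0.
  - exact: mrho_t.
  - exact: r_lim.
  - move=> f cf bf.
    have phi_oo : phi @ \oo --> \oo.
      move=> B [N _ NB]; exists N => // n Nn; apply: NB.
      exact: leq_trans Nn (increasing_seq_ge incr n).
    exact: (cvg_comp phi _ phi_oo (narrow f cf bf)).
split => //.
(* The exceptional set has null sections at all nonnegative times. *)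
pose B := [set p : R * R | 0 <= p.1] `&` (fun p => rho p.1 p.2) @^-1` `]-oo, 0[.
have mB : measurable B by apply: mrho => //; exact: measurable_itv.
exists B; split => //; last first.
  move=> p /= /not_implyP[p0 /negP]; rewrite -ltNge => rp.
  by split => //=; rewrite in_itv.
apply: integral0_eq => t _ /=.
have [t0|t0] := leP 0 t; last first.
  rewrite (_ : xsection B t = set0) ?measure0//.
  by apply/seteqP; split => // x /xsectionP[/=]; rewrite leNgt t0.
apply/negligibleP; first exact: measurable_xsection.
have [_ [_ rho_ge0 _]] := rhoX t t0.
apply: negligibleS rho_ge0 => x /xsectionP[_ /=].
by rewrite in_itv/= => rx; apply/negP; rewrite -ltNge.
Qed.
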